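(* Let $X$ be a finite simplicial complex and let $\widetilde{X}$ be an infinite regular covering of $X$ with covering group $\Gamma$. Suppose that $\Gamma$ has exponential growth, that $\{\Gamma_i\}$ is a uniform family of finite index normal subgroups of $\Gamma$, and that the Laplacian $\Delta_q$ on $\widetilde{X}$ has no spectrum below $\lambda_0$, where $\lambda_0>0$. Put $X_i=\widetilde{X}/\Gamma_i$. (a) There are $C>0$ and $\beta<1$ such that for all $i$, $$b_q(X_i)<C\,[\Gamma:\Gamma_i]^{\beta}.$$ (b) Fix $\lambda<\lambda_0$. There are $C>0$ and $\beta<1$ such that for all $i$, $$\#\bigl\{\mu\le\lambda\ \big|\ \mu\text{ is an eigenvalue of }\Delta_q\text{ on }X_i\bigr\}<C\,[\Gamma:\Gamma_i]^{\beta}.$$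
   Context: $\Gamma$ is a finitely generated infinite group acting freely and simplicially on $\widetilde{X}$ with $\widetilde{X}/\Gamma=X$, equipped with the word metric of a fixed finite generating set. $\Delta_q$ on $\widetilde{X}$ is the combinatorial Laplacian on $\ell^2$ $q$-cochains of $\widetilde{X}$; $\Delta_q$ on $X_i$ is the combinatorial Laplacian on $q$-cochains of the finite complex $X_i$. $b_q$ is the ordinary $q$-th Betti number. For a nontrivial subgroup $\Gamma'\le\Gamma$, $\mathrm{short}(\Gamma')$ is the word length of the shortest non-identity element of $\Gamma'$. A family $\{\Gamma_i\}$ of finite index normal subgroups of $\Gamma$ is uniform if there is $C>0$ such that $[\Gamma:\Gamma_i]\le \mathrm{Vol}(B_\Gamma(C\cdot\mathrm{short}(\Gamma_i)))$ for all $i$, where $B_\Gamma(r)$ is the ball of radius $r$ in $\Gamma$ in the word metric and $\mathrm{Vol}$ is the number of its elements. *)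

(* Defs.v *)
From HB Require Import structures.
From mathcomp Require Import all_boot all_order all_algebra perm monoid finmap.
From mathcomp Require Import mathcomp_extra boolp classical_sets functions.
From mathcomp Require Import cardinality fsbigop reals ereal esum exp.

Set Implicit Arguments.
Unset Strict Implicit.
Unset Printing Implicit Defensive.

Import Order.TTheory GRing.Theory Num.Theory.

Local Open Scope classical_set_scope.
Local Open Scope ring_scope.

(** * Finitely generated groups *)

Section Groups.
Variable G : groupType.
Implicit Types (S : {fset G}) (H : set G) (g h : G).

(* The least element of P, and 0 if P is empty. *)
Definition least (P : set nat) : nat :=
  xget 0%N [set n | P n /\ forall m, P m -> (n <= m)%N].

(* w is a word in the alphabet S `|` S^-1 with value g. *)
Definition spells S (w : seq G) g : Prop :=
  (forall x, x \in w -> x \in S \/ (x^-1)%g \in S) /\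
  foldr (fun x y => (x * y)%g) 1%g w = g.

Definition generates S : Prop := forall g, exists w, spells S w g.

Definition word_length S g : nat :=
  least [set n | exists2 w, spells S w g & size w = n].

Definition word_ball (R : realType) S (r : R) : set G :=
  [set g | (word_length S g)%:R <= r].

Definition vol (R : realType) S (r : R) : nat :=
  #|` fset_set (word_ball S r)|%fset.

Definition exponential_growth (R : realType) S : Prop :=
  exists c a : R, [/\ 0 < c, 1 < a &
    forall n : nat, c * a ^+ n <= (vol S (n%:R : R))%:R].

Definition normal_subgroup H : Prop :=
  [/\ H 1%g, forall g h, H g -> H h -> H (g * h^-1)%g
    & forall g h, H h -> H (g^-1 * (h * g))%g].

Definition cosets H : set (set G) :=
  range (fun g : G => [set (g * h)%g | h in H]).

Definition finite_index H : Prop := finite_set (cosets H).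

(* Only meaningful when [finite_index H]. *)
Definition subgroup_index H : nat := #|` fset_set (cosets H)|%fset.

(* Only meaningful when H is nontrivial. *)
Definition short S H : nat :=
  least [set n | exists g, [/\ H g, g <> 1%g & word_length S g = n]].

Definition uniform_family (R : realType) S (I : Type) (Gi : I -> set G) : Prop :=
  exists2 C : R, 0 < C &
    forall i, (subgroup_index (Gi i) <= vol S (C * (short S (Gi i))%:R : R))%N.

End Groups.

(** * Simplicial complexes *)

(* The vertices are the v such that [fset v] is a simplex; they need not
   exhaust V. *)
Record scomplex (V : choiceType) := SComplex {
  simplex :> {fset V} -> Prop;
  simplex_neq0 : forall s : {fset V}, simplex s -> s <> fset0;
  simplex_face : forall s t : {fset V},
    simplex s -> (t `<=` s)%fset -> t <> fset0 -> simplex t }.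

Section Coverings.
Variables (G : groupType) (V W : choiceType).

Definition covering (Y : scomplex W) (X : scomplex V) (p : W -> V) : Prop :=
  [/\ forall s, Y s -> X [fset p w | w in s]%fset,
      forall s, Y s -> {in s &, injective p},
      forall v, X [fset v]%fset -> exists2 w, Y [fset w]%fset & p w = v
    & forall w t, Y [fset w]%fset -> X t -> p w \in t ->
        exists! s, [/\ Y s, w \in s & [fset p w' | w' in s]%fset = t] ].

Definition group_action (act : G -> W -> W) : Prop :=
  (forall w, act 1%g w = w) /\
  (forall g h w, act (g * h)%g w = act g (act h w)).

Definition simplicial_action (act : G -> W -> W) (Y : scomplex W) : Prop :=
  forall g s, Y s -> Y [fset act g w | w in s]%fset.

(* Freeness on the geometric realization: g fixes a point of it iff g
   stabilizes a simplex setwise. *)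
Definition free_action (act : G -> W -> W) (Y : scomplex W) : Prop :=
  forall g s, Y s -> [fset act g w | w in s]%fset = s -> g = 1%g.

Definition regular_covering (act : G -> W -> W) (Y : scomplex W)
    (X : scomplex V) (p : W -> V) : Prop :=
  [/\ covering Y X p, group_action act, simplicial_action act Y,
      free_action act Y
    & forall w w', Y [fset w]%fset -> Y [fset w']%fset ->
        (p w = p w' <-> exists g, w' = act g w) ].

End Coverings.

(* Y / H: its vertices are the H-orbits of vertices of Y, its simplices the
   images of the simplices of Y. *)
Section Quotient.
Variables (G : groupType) (W : choiceType) (act : G -> W -> W).
Variables (H : set G) (Y : scomplex W).

Definition orbit_map (w : W) : set W := [set act h w | h in H].

Definition quotient_simplex : set {fset (set W)} :=
  [set t | exists2 s, Y s & [fset orbit_map w | w in s]%fset = t].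

Lemma quotient_simplex_neq0 t : quotient_simplex t -> t <> fset0.
Proof.
case=> s Ys <- s0; apply: (simplex_neq0 Ys).
apply/fsetP => w; rewrite in_fset0; apply/negP => ws.
have : orbit_map w \in [fset orbit_map w | w in s]%fset by rewrite in_imfset.
by rewrite s0 in_fset0.
Qed.

Lemma quotient_simplex_face s t : quotient_simplex s ->
  (t `<=` s)%fset -> t <> fset0 -> quotient_simplex t.
Proof.
case=> s' Ys' <- /fsubsetP ts t0.
have im : [fset orbit_map w | w in [fset w in s' | orbit_map w \in t]]%fset = t.
  apply/fsetP => a; apply/imfsetP/idP => [[w /=]|at_].
    by rewrite !inE /= => /andP[_ wt] ->.
  have /imfsetP[w /= ws aE] := ts _ at_.
  by exists w => //=; rewrite !inE /= ws -aE.
exists [fset w in s' | orbit_map w \in t]%fset => //.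
apply: (simplex_face Ys'); first by apply/fsubsetP => w; rewrite !inE => /andP[].
move=> e; apply: t0; rewrite -im e.
by apply/fsetP => a; rewrite in_fset0; apply/imfsetP => -[w /=]; rewrite in_fset0.
Qed.

Definition quotient_complex : scomplex (set W) :=
  SComplex quotient_simplex_neq0 quotient_simplex_face.

End Quotient.

(** * Cochains and the combinatorial Laplacian *)

(* Real q-cochains are alternating functions of (q+1)-tuples of vertices
   spanning a simplex, extended by 0 to all tuples. Below n is q + 1; since
   the empty tuple spans no simplex, n = 0 gives the zero space. *)
Section Cochains.
Variables (R : realType) (V : choiceType) (K : scomplex V).

Definition spans_simplex n (t : n.-tuple V) : Prop :=
  uniq t /\ K [fset v in (t : seq V)]%fset.

Definition cochain n : set (n.-tuple V -> R^o) :=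
  [set f | (forall t, ~ spans_simplex t -> f t = 0) /\
    (forall (s : 'S_n) t, f [tuple tnth t (s i) | i < n] = (-1) ^+ s * f t)].

Definition tuple_face n (t : n.+1.-tuple V) (i : 'I_n.+1) : n.-tuple V :=
  [tuple tnth t (lift i j) | j < n].

Definition coboundary n (f : n.-tuple V -> R^o) : n.+1.-tuple V -> R^o :=
  fun t => if `[< spans_simplex t >]
           then \sum_(i < n.+1) (-1) ^+ i * f (tuple_face t i) else 0.

(* The adjoint of [coboundary] for the inner product whose squared norm is
   [sqnorm] below. The sum has finite support when K is locally finite. *)
Definition cocoboundary n (f : n.+1.-tuple V -> R^o) : n.-tuple V -> R^o :=
  fun t => if `[< spans_simplex t >]
           then \sum_(v \in [set: V]) f [tuple of v :: t] else 0.

Definition laplacian q (f : q.+1.-tuple V -> R^o) : q.+1.-tuple V -> R^o :=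
  cocoboundary (coboundary f) + coboundary (cocoboundary f).

(* Each q-simplex is counted once: it is spanned by n`! tuples. *)
Definition sqnorm n (f : n.-tuple V -> R^o) : \bar R :=
  ((n`!%:R^-1 : R)%:E * \esum_(t in [set: n.-tuple V]) ((f t : R) ^+ 2)%:E)%E.

Definition l2_cochain n : set (n.-tuple V -> R^o) :=
  [set f | cochain f /\ (sqnorm f < +oo)%E].

Definition laplacian_resolvent q : set R :=
  [set mu | let T := fun f : q.+1.-tuple V -> R^o => laplacian f - mu *: f in
    set_bij (@l2_cochain q.+1) (@l2_cochain q.+1) T /\
    exists M : R, forall f, l2_cochain f -> (sqnorm f <= M%:E * sqnorm (T f))%E].

Definition laplacian_spectrum q : set R := ~` laplacian_resolvent q.

End Cochains.

(** * Betti numbers and eigenvalues of finite complexes *)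

Section Dimension.
Variables (R : realType) (U : lmodType R).

Definition is_quotient_dim (Z B : set U) (n : nat) : Prop :=
  exists b : 'I_n -> U,
    [/\ forall i, Z (b i),
        forall c : 'I_n -> R, B (\sum_i c i *: b i) -> forall i, c i = 0
      & forall z, Z z -> exists c : 'I_n -> R, B (z - \sum_i c i *: b i)].

(* dim Z / B for subspaces B `<=` Z with finite-dimensional quotient. *)
Definition quotient_dim (Z B : set U) : nat := xget 0%N (is_quotient_dim Z B).

End Dimension.

Section FiniteComplex.
Variables (R : realType) (V : choiceType) (K : scomplex V) (q : nat).

Definition cocycles : set (q.+1.-tuple V -> R^o) :=
  [set f | cochain K f /\ coboundary K f = 0].

Definition coboundaries : set (q.+1.-tuple V -> R^o) :=
  [set coboundary K f | f in @cochain R V K q].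

Definition betti : nat := quotient_dim cocycles coboundaries.

Definition laplacian_eigenspace (mu : R) : set (q.+1.-tuple V -> R^o) :=
  [set f | cochain K f /\ laplacian K f = mu *: f].

(* Number of eigenvalues mu <= lambda, counted with multiplicity. *)
Definition eigenvalue_count (lambda : R) : nat :=
  \sum_(mu \in [set mu : R | mu <= lambda])
     quotient_dim (laplacian_eigenspace mu) [set 0].

End FiniteComplex.

(* Main.v *)
(* Put A = 1 - Delta / K with K a bound for Delta on the cover. The spectral gap
   says <Delta u, u> >= lambda0 |u|^2, so |A^j u| <= (1 - lambda0 / K)^j |u|.
   The cochain A^j delta_t is supported within distance O(j) of the simplex t,
   where the projection to X_i is injective as long as j is at most a constant
   times short(Gamma_i). For orthonormal eigencochains F_k of X_i with eigenvalues
   at most lambda, Bessel's inequality for the pullbacks of the F_k then gives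
     (1 - lambda / K)^(2 j) \sum_k F_k(t)^2 <= (1 - lambda0 / K)^(2 j).
   Summing over t, the number of the F_k is at most [Gamma : Gamma_i] times a
   quantity decaying exponentially in short(Gamma_i), while by uniformity
   [Gamma : Gamma_i] is at most exponential in short(Gamma_i). Betti numbers are
   the case lambda = 0, by Hodge theory. *)

From HB Require Import structures.
Require Import Defs.
From mathcomp Require Import all_boot all_order all_algebra perm monoid finmap.
From mathcomp Require Import mathcomp_extra boolp classical_sets functions.
From mathcomp Require Import cardinality fsbigop reals ereal esum exp.
From mathcomp Require Import zify ring lra.

Set Implicit Arguments.
Unset Strict Implicit.
Unset Printing Implicit Defensive.

Import Order.TTheory GRing.Theory Num.Theory.

Local Open Scope classical_set_scope.
Local Open Scope ring_scope.

(** * Symmetric operators on inner product spaces *)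

(** All operators act on finitely supported cochains, where estimates reduce to finite sums and
    positivity of forms. The price is that the absence of spectrum below lambda0, a statement about
    bounded inverses on l2, must first be turned into an inequality of forms
    ([form_ge_of_resolvent]). The number K is taken so large that A has a nonnegative form. Then the
    norm of A is governed by the lower bound of Delta alone, and the factor (1 - mu / K)^j of an
    eigencochain is at least (1 - lambda / K)^j whenever mu <= lambda. The pullbacks of the F_k are
    in general not square summable, so A is moved onto them only inside pairings with a finitely
    supported cochain. This is why the adjointness lemmas ask for finite support on one side. [fdot]
    sums over ordered tuples without the factor 1 / n! of [sqnorm], so it counts a simplex n! times;
    this is the origin of the factor n + 1 in [coboundary_adjoint] and of the later factorials. *)

Section InnerProduct.
Variables (R : realType) (U : lmodType R).
Implicit Types (P Z B : set U) (u v w : U) (L : U -> U).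

Record lin_subspace P : Prop := LinSubspace {
  lin_subspace0 : P 0;
  lin_subspaceP : forall a u v, P u -> P v -> P (a *: u + v) }.

Lemma lin_subspaceD P u v : lin_subspace P -> P u -> P v -> P (u + v).
Proof. by move=> sP Pu Pv; rewrite -[u]scale1r; apply: lin_subspaceP. Qed.

Lemma lin_subspaceZ P a u : lin_subspace P -> P u -> P (a *: u).
Proof. by move=> sP Pu; rewrite -[_ *: _]addr0; apply: lin_subspaceP (lin_subspace0 _). Qed.

Lemma lin_subspaceB P u v : lin_subspace P -> P u -> P v -> P (u - v).
Proof. by move=> sP Pu Pv; rewrite addrC -scaleN1r; apply: lin_subspaceP. Qed.

Lemma lin_subspace_sum P (I : Type) (r : seq I) (c : I -> R) (e : I -> U) :
  lin_subspace P -> (forall i, P (e i)) -> P (\sum_(i <- r) c i *: e i).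
Proof.
move=> sP Pe; elim/big_ind: _ => [|u v|i _]; first exact: (lin_subspace0 sP).
  exact: lin_subspaceD.
exact: lin_subspaceZ.
Qed.

Record inner_product P (dot : U -> U -> R) : Prop := InnerProduct {
  ip_subspace : lin_subspace P;
  dotC : forall u v, dot u v = dot v u;
  dot_lin : forall a u v w, P u -> P v -> P w ->
    dot (a *: u + v) w = a * dot u w + dot v w;
  dot_ge0 : forall u, 0 <= dot u u;
  dot_eq0 : forall u, P u -> dot u u = 0 -> u = 0 }.

Variables (P : set U) (dot : U -> U -> R) (ip : inner_product P dot).
Let sP := ip_subspace ip.

Lemma dot0l w : P w -> dot 0 w = 0.
Proof.
move=> Pw; have := dot_lin ip 1 (lin_subspace0 sP) (lin_subspace0 sP) Pw.
rewrite scaler0 addr0 mul1r; lra.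
Qed.

Lemma dotDl u v w : P u -> P v -> P w -> dot (u + v) w = dot u w + dot v w.
Proof. by move=> Pu Pv Pw; rewrite -{1}[u]scale1r (dot_lin ip) // mul1r. Qed.

Lemma dotZl a u w : P u -> P w -> dot (a *: u) w = a * dot u w.
Proof.
move=> Pu Pw.
by rewrite -[a *: u]addr0 (dot_lin ip) ?dot0l ?addr0 //; exact: (lin_subspace0 sP).
Qed.

Lemma dotBl u v w : P u -> P v -> P w -> dot (u - v) w = dot u w - dot v w.
Proof.
move=> Pu Pv Pw; rewrite addrC -scaleN1r (dot_lin ip) //; ring.
Qed.

Lemma dotZr a u w : P u -> P w -> dot w (a *: u) = a * dot w u.
Proof. by move=> Pu Pw; rewrite (dotC ip) dotZl // (dotC ip). Qed.

Lemma dotBr u v w : P u -> P v -> P w -> dot w (u - v) = dot w u - dot w v.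
Proof. by move=> Pu Pv Pw; rewrite (dotC ip) dotBl // !(dotC ip _ w). Qed.

Lemma dot_suml (I : Type) (r : seq I) (c : I -> R) (e : I -> U) w :
  (forall i, P (e i)) -> P w ->
  dot (\sum_(i <- r) c i *: e i) w = \sum_(i <- r) c i * dot (e i) w.
Proof.
move=> Pe Pw; elim: r => [|i r IH]; first by rewrite !big_nil dot0l.
rewrite !big_cons dotDl ?dotZl ?IH //; first exact: lin_subspaceZ.
exact: lin_subspace_sum.
Qed.

Definition orthonormal_family (I : eqType) (e : I -> U) : Prop :=
  forall i j, dot (e i) (e j) = (i == j)%:R.

Lemma dot_orthonormal_suml (I : finType) (c : I -> R) (e : I -> U) i :
  (forall i, P (e i)) -> orthonormal_family e ->
  dot (\sum_i c i *: e i) (e i) = c i.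
Proof.
move=> Pe oe; rewrite dot_suml // (bigD1 i) //= oe eqxx mulr1 big1 ?addr0 //.
by move=> j /negPf ji; rewrite oe ji mulr0.
Qed.

Lemma sqnorm_orthonormal_sum (I : finType) (c : I -> R) (e : I -> U) :
  (forall i, P (e i)) -> orthonormal_family e ->
  dot (\sum_i c i *: e i) (\sum_i c i *: e i) = \sum_i c i ^+ 2.
Proof.
move=> Pe oe; have Ps : P (\sum_i c i *: e i) by apply: lin_subspace_sum.
rewrite dot_suml //; apply: eq_bigr => i _.
by rewrite (dotC ip) dot_orthonormal_suml // expr2.
Qed.

Lemma eq_dot0 u : P u -> (dot u u == 0) = (u == 0).
Proof.
move=> Pu; apply/eqP/eqP => [|->]; first exact: (dot_eq0 ip).
by rewrite dot0l //; exact: (lin_subspace0 sP).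
Qed.

Lemma dot_gt0 u : P u -> u != 0 -> 0 < dot u u.
Proof. by move=> Pu u0; rewrite lt0r (dot_ge0 ip) andbT eq_dot0. Qed.

Section Symmetric.
Variables (L : U -> U).

Record symmetric_op : Prop := SymmetricOp {
  sym_stable : forall u, P u -> P (L u);
  sym_lin : forall a u v, P u -> P v -> L (a *: u + v) = a *: L u + L v;
  sym_dot : forall u v, P u -> P v -> dot (L u) v = dot u (L v) }.

(* Positivity of the form <L., .> at u - L u / K. *)
Lemma sqnorm_le_form K (symL : symmetric_op) : 0 < K ->
    (forall u, P u -> 0 <= dot (L u) u) ->
    (forall u, P u -> dot (L u) u <= K * dot u u) ->
  forall u, P u -> dot (L u) (L u) <= K * dot (L u) u.
Proof.
move=> K0 L0 LK u Pu; have PL := sym_stable symL.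
pose s := K^-1; have s0 : 0 < s by rewrite invr_gt0.
have PsL : P (- s *: L u) by apply: lin_subspaceZ => //; apply: PL.
have := L0 (- s *: L u + u) (lin_subspaceP sP _ (PL _ Pu) Pu).
have PLLu : P (L (L u)) by apply: (PL); apply: (PL).
have PLu : P (L u) by apply: PL.
rewrite (sym_lin symL) // (dot_lin ip) //; last exact: lin_subspaceP.
rewrite ![dot _ (- s *: _ + _)](dotC ip) !(dot_lin ip) //.
rewrite [dot (L u) (L (L u))](dotC ip) [dot u (L (L u))](dotC ip).
rewrite (sym_dot symL (PL _ Pu) Pu) [dot u (L u)](dotC ip).
have := LK _ PLu; set x := dot (L (L u)) (L u); set y := dot (L u) (L u).
set z := dot (L u) u => xy h.
have sK : s * K = 1 by rewrite /s mulVf // gt_eqF.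
have : 0 <= K * (- s * (- s * x + y) + (- s * y + z)) by rewrite mulr_ge0 // ltW.
have -> : K * (- s * (- s * x + y) + (- s * y + z)) =
  (s * K) * s * x - 2 * (s * K) * y + K * z by ring.
rewrite sK !mul1r mulr1; suff : s * x <= y by lra.
by rewrite mulrC ler_pdivrMr // mulrC.
Qed.

End Symmetric.

Lemma symmetric_op_affine L a b : symmetric_op L ->
  symmetric_op (fun u => a *: u + b *: L u).
Proof.
move=> symL; have PL := sym_stable symL; split=> [u Pu|c u v Pu Pv|u v Pu Pv].
- by apply: (lin_subspaceP sP) => //; apply: (lin_subspaceZ _ sP); apply: PL.
- rewrite (sym_lin symL) // !scalerDr !scalerA [c * a]mulrC [c * b]mulrC.
  by rewrite addrACA.
- have PLu := PL _ Pu; have PLv := PL _ Pv; rewrite /=.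
  rewrite (dot_lin ip) ?dotZl //; last exact: lin_subspaceZ.
  rewrite [dot u (_ + _)](dotC ip) (dot_lin ip) ?dotZl //; last exact: lin_subspaceZ.
  by rewrite (sym_dot symL) // [dot (L v) u](dotC ip) [dot v u](dotC ip).
Qed.

(* If the optimal lower bound m of the form were < l0, then the bound on the
   inverse of L - m would make the form at least m + 1 / (K M). *)
Lemma form_ge_of_resolvent L K l0 : symmetric_op L -> 0 < K -> 0 <= l0 ->
    (forall u, P u -> 0 <= dot (L u) u) ->
    (forall u, P u -> dot (L u) u <= K * dot u u) ->
    (forall mu, mu < l0 -> exists M, forall u, P u ->
       dot u u <= M * dot (L u - mu *: u) (L u - mu *: u)) ->
  forall u, P u -> l0 * dot u u <= dot (L u) u.
Proof.
move=> symL K0 l00 L0 LK res; have PL := sym_stable symL.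
(* The cap [l0] keeps this set bounded above even if [P] is zero and every m bounds the form. *)
pose E := [set m | m <= l0 /\ forall u, P u -> m * dot u u <= dot (L u) u].
have E0 : E 0 by split=> // u Pu; rewrite mul0r; exact: L0.
have ubE : ubound E l0 by move=> m [].
have supE : has_sup E by split; [exists 0 | exists l0].
have ml0 : sup E <= l0 by apply: ge_sup => //; exists 0.
have Em : E (sup E).
  split=> // u Pu; have [->|u0] := eqVneq u 0.
    have P0 := lin_subspace0 sP.
    by rewrite (dotC ip (L 0)) !dot0l ?mulr0 //; exact: PL.
  rewrite -ler_pdivlMr ?dot_gt0 //; apply: ge_sup; first by exists 0.
  by move=> m [_ hm]; rewrite ler_pdivlMr ?dot_gt0 //; exact: hm.
have m0 : 0 <= sup E by apply: ub_le_sup => //; exists l0.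
move: ml0; rewrite le_eqVlt => /orP[/eqP <-|ml0]; first exact: Em.2.
exfalso; set m := sup E in Em m0 ml0.
have [M HM] := res _ ml0.
have symT : symmetric_op (fun u => (- m) *: u + 1 *: L u) by apply: symmetric_op_affine.
have TE u : (- m) *: u + 1 *: L u = L u - m *: u by rewrite scale1r addrC scaleNr.
have dT u : P u -> dot ((- m) *: u + 1 *: L u) u = dot (L u) u - m * dot u u.
  move=> Pu; rewrite (dot_lin ip) ?scale1r //; last exact: PL.
  by rewrite addrC mulNr.
have bT := sqnorm_le_form symT K0.
have {}bT u : P u -> dot (L u - m *: u) (L u - m *: u) <= K * (dot (L u) u - m * dot u u).
  move=> Pu; rewrite -TE -dT //; apply: bT => // v Pv; rewrite dT //.
    by rewrite subr_ge0; exact: Em.2.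
  have := mulr_ge0 m0 (dot_ge0 ip v); have := LK _ Pv; lra.
(* [M] may be nonpositive, hence the maximum with 1; the minimum in [d] keeps m + d at most [l0], as
   membership in [E] demands. *)
pose N := Num.max M 1; have N0 : 0 < N by rewrite lt_max ltr01 orbT.
pose d := Num.min (N * K)^-1 (l0 - m).
have d0 : 0 < d by rewrite lt_min invr_gt0 mulr_gt0 //= subr_gt0.
suff : E (m + d).
  move=> Ed; have : m + d <= m by apply: ub_le_sup => //; exists l0.
  by lra.
have dl : d <= l0 - m by rewrite ge_min lexx orbT.
split; first by lra.
move=> u Pu; rewrite mulrDl -lerBrDl.
apply: (@le_trans _ _ ((N * K)^-1 * dot u u)).
  by apply: ler_wpM2r; [exact: (dot_ge0 ip)|rewrite ge_min lexx].
rewrite mulrC ler_pdivrMr ?mulr_gt0 // mulrC -mulrA.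
apply: le_trans (HM _ Pu) _.
apply: (@le_trans _ _ (N * dot (L u - m *: u) (L u - m *: u))).
  by apply: ler_wpM2r; [exact: (dot_ge0 ip)|rewrite le_max lexx].
by apply: ler_wpM2l; [exact: ltW|exact: bT].
Qed.

(** The form of A = 1 - L / K lies between 0 and a = 1 - l0 / K, so [sqnorm_le_form], applied to A
    with bound a, gives |A v|^2 <= a <A v, v> <= a^2 |v|^2. A is spelled with scalars 1 and -1 / K
    to be an instance of [symmetric_op_affine]. *)
Lemma iter_affine_sqnorm L K l0 j : symmetric_op L -> 0 < l0 < K ->
    (forall u, P u -> l0 * dot u u <= dot (L u) u) ->
    (forall u, P u -> dot (L u) u <= K * dot u u) ->
  forall u, P u ->
    P (iter j (fun u => 1 *: u + (- K^-1) *: L u) u) /\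
    dot (iter j (fun u => 1 *: u + (- K^-1) *: L u) u)
        (iter j (fun u => 1 *: u + (- K^-1) *: L u) u)
      <= (1 - l0 / K) ^+ j.*2 * dot u u.
Proof.
move=> symL /andP[l00 lK] Ll LK u Pu; have K0 : 0 < K by lra.
set A := fun _ => _; have symA : symmetric_op A by exact: symmetric_op_affine.
pose a := 1 - l0 / K.
have a0 : 0 < a by rewrite subr_gt0 ltr_pdivrMr // mul1r.
have dA v : P v -> dot (A v) v = dot v v - dot (L v) v / K.
  move=> Pv; have PLv := sym_stable symL Pv.
  by rewrite (dot_lin ip) ?dotZl // ?mul1r ?mulNr ?[K^-1 * _]mulrC //; exact: lin_subspaceZ.
have A0 v : P v -> 0 <= dot (A v) v.
  by move=> Pv; rewrite dA // subr_ge0 ler_pdivrMr // mulrC; exact: LK.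
have Aa v : P v -> dot (A v) v <= a * dot v v.
  move=> Pv; rewrite dA // /a mulrBl mul1r lerD2l lerN2 mulrAC.
  by rewrite ler_pM2r ?invr_gt0 //; exact: Ll.
elim: j => [|j [Pj IH]]; first by rewrite /= expr0 mul1r.
have PA := sym_stable symA Pj; split=> //=; rewrite doubleS !exprS -/a -!mulrA.
apply: le_trans (sqnorm_le_form symA a0 A0 Aa Pj) _.
rewrite ler_pM2l //; apply: le_trans (Aa _ Pj) _.
by rewrite ler_pM2l.
Qed.

(** * Orthonormal families *)

Section Maximal.
Variables (Z : set U) (N : nat).
Hypotheses (sZ : lin_subspace Z) (ZP : Z `<=` P).
Hypothesis dimZ : forall m (e : 'I_m -> U),
  (forall i, Z (e i)) -> orthonormal_family e -> (m <= N)%N.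

(** An orthonormal family of maximal length spans: a nonzero remainder of some z would be orthogonal
    to it and, once normalized, would extend it. The hypothesis [dimZ] expresses finite dimension as
    a bound on the lengths of orthonormal families. *)
Lemma maximal_orthonormal : exists m (e : 'I_m -> U),
  [/\ forall i, Z (e i), orthonormal_family e
    & forall z, Z z -> z = \sum_i dot z (e i) *: e i].
Proof.
pose Q m := `[< exists e : 'I_m -> U, (forall i, Z (e i)) /\ orthonormal_family e >].
have Q0 : Q 0%N by apply/asboolP; exists (fun=> 0); split=> - [].
have QN m : Q m -> (m <= N)%N by move=> /asboolP[e []]; exact: dimZ.
have exQ : exists m, Q m by exists 0%N.
have [m /asboolP[e [Ze oe]] mmax] := ex_maxnP exQ QN.
exists m, e; split=> // z Zz; set s := \sum_i _.
have Zs : Z s by apply: lin_subspace_sum.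
apply/eqP; rewrite -subr_eq0; apply/negPn/negP => w0.
set w := z - s in w0; have Zw : Z w by apply: lin_subspaceB.
have we i : dot w (e i) = 0.
  rewrite dotBl ?dot_orthonormal_suml ?subrr //; try exact: ZP.
  by move=> k; exact: ZP.
pose c := Num.sqrt (dot w w); have ww := dot_gt0 (ZP Zw) w0.
have c0 : 0 < c by rewrite sqrtr_gt0.
have cc : c * c = dot w w by rewrite -expr2 sqr_sqrtr // ltW.
pose f (i : 'I_m.+1) := if unlift ord0 i is Some k then e k else c^-1 *: w.
suff : (m < m)%N by rewrite ltnn.
apply: mmax; apply/asboolP; exists f; split=> [i|i j].
  by rewrite /f; case: unliftP => // _; exact: lin_subspaceZ.
have Zc : Z (c^-1 *: w) by exact: lin_subspaceZ.
rewrite /f; case: unliftP => [k|] ->; case: unliftP => [l|] ->.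
- by rewrite oe (inj_eq (@lift_inj _ _)).
- by rewrite dotZr ?(dotC ip _ w) ?we ?mulr0 //; exact: ZP.
- by rewrite dotZl ?we ?mulr0 ?(negPf (neq_lift _ _)) //; exact: ZP.
- rewrite eqxx dotZl ?dotZr //; try exact: ZP.
  by rewrite -cc mulr1n; field; rewrite gt_eqF.
Qed.

End Maximal.

Lemma lin_comb_kernel n m (M : 'M[R]_(n, m)) : (m < n)%N ->
  exists2 c : 'I_n -> R, (exists i, c i != 0) &
    forall j, \sum_i c i * M i j = 0.
Proof.
move=> mn; have : kermx M != 0.
  rewrite kermx_eq0 /row_free; apply/negP => /eqP rM.
  by have := rank_leq_col M; rewrite rM leqNgt mn.
case/rowV0Pn => v /sub_kermxP vM v0.
exists (fun i => v 0 i) => [|j].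
  by have /rV0Pn[i vi] := v0; exists i.
by have := congr1 (fun A : 'rV_m => A 0 j) vM; rewrite !mxE.
Qed.

(** Let e be a maximal orthonormal family of length m in the orthogonal complement of [B] in [Z]. If
    m < n, some nontrivial combination of representatives of a basis of Z / B has zero component in
    that complement, hence lies in [B], against independence. *)
Lemma quotient_dim_orthonormal Z B N n : lin_subspace Z -> lin_subspace B ->
    B `<=` Z -> Z `<=` P ->
    (forall m (e : 'I_m -> U), (forall i, Z (e i)) -> orthonormal_family e -> (m <= N)%N) ->
    is_quotient_dim Z B n ->
  exists e : 'I_n -> U, [/\ forall i, Z (e i),
    forall i b, B b -> dot (e i) b = 0 & orthonormal_family e].
Proof.
move=> sZ sB BZ ZP dimZ [b [Zb freeb _]].
have dimB m (e : 'I_m -> U) : (forall i, B (e i)) -> orthonormal_family e -> (m <= N)%N.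
  by move=> Be; apply: dimZ => i; exact: BZ.
have [k [f [Bf of_ fE]]] := maximal_orthonormal sB (subset_trans BZ ZP) dimB.
pose Y := [set z | Z z /\ forall b, B b -> dot z b = 0].
have sY : lin_subspace Y.
  split=> [|a u v [Zu Bu] [Zv Bv]].
    by split=> [|c Bc]; [exact: (lin_subspace0 sZ)|rewrite dot0l //; exact/ZP/BZ].
  split=> [|c Bc]; first exact: lin_subspaceP.
  by rewrite (dot_lin ip) ?Bu ?Bv ?mulr0 ?addr0 //; apply: ZP => //; exact: BZ.
have YZ : Y `<=` Z by move=> z [].
have dimY m (e : 'I_m -> U) : (forall i, Y (e i)) -> orthonormal_family e -> (m <= N)%N.
  by move=> Ye; apply: dimZ => i; exact: YZ.
have [m [e [Ye oe eE]]] := maximal_orthonormal sY (subset_trans YZ ZP) dimY.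
have [nm|mn] := leqP n m.
  pose wi := widen_ord nm; exists (e \o wi); split=> [i|i c Bc|i j] /=.
  - exact: (Ye _).1.
  - exact: (Ye _).2.
  - by rewrite oe.
(* [pr] is the orthogonal projection onto [B]. *)
exfalso; pose pr z := \sum_i dot z (f i) *: f i.
have Bpr z : B (pr z) by exact: lin_subspace_sum.
have Ypr z : Z z -> Y (z - pr z).
  move=> Zz; split=> [|c Bc]; first by apply: lin_subspaceB => //; exact: BZ.
  have Pc : P c by exact/ZP/BZ.
  have Pf i : P (f i) by exact/ZP/BZ.
  rewrite dotBl //; [|exact: ZP|exact/ZP/BZ].
  rewrite {1}(fE c Bc) (dotC ip z) !dot_suml // ?subr_eq0; last exact: ZP.
  apply/eqP; rewrite subr_eq0; apply/eqP; apply: eq_bigr => i _.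
  by rewrite mulrC (dotC ip z) (dotC ip c).
(* There are m linear conditions on n > m coefficients: the remainder of the combination is to be
   orthogonal to every e j. *)
have [c [i ci] cM] := lin_comb_kernel (\matrix_(i, j) dot (b i - pr (b i)) (e j)) mn.
move/eqP: ci; apply; apply: freeb.
have -> : \sum_i c i *: b i = \sum_i c i *: pr (b i) + \sum_i c i *: (b i - pr (b i)).
  by rewrite -big_split; apply: eq_bigr => k' _ /=; rewrite -scalerDr addrC subrK.
have -> : \sum_i c i *: (b i - pr (b i)) = 0.
  under eq_bigr => i' _ do rewrite (eE _ (Ypr _ (Zb i'))) scaler_sumr.
  rewrite exchange_big big1 //= => j _.
  under eq_bigr => i' _ do rewrite scalerA.
  rewrite -scaler_suml; have := cM j; under eq_bigr => i' _ do rewrite mxE.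
  by move=> ->; rewrite scale0r.
by rewrite addr0; exact: lin_subspace_sum.
Qed.

End InnerProduct.

(** * Finitely supported functions *)

Section FiniteSupport.
Variables (R : realType) (T : choiceType).
Implicit Types f g h : T -> R^o.

Definition fin_supp f : Prop := finite_set [set t | f t != 0].

(** A finitely supported sum: it takes the value 0 when infinitely many terms are nonzero, so
    additivity always comes with a finiteness hypothesis. *)
Definition fdot f g : R := \sum_(t \in [set: T]) (f t * g t : R).

Lemma fin_supp_sub f (A : set T) : finite_set A ->
  (forall t, f t != 0 -> A t) -> fin_supp f.
Proof. by move=> fA fsA; apply: sub_finite_set fA. Qed.

Lemma fin_suppP a f g : fin_supp f -> fin_supp g -> fin_supp (a *: f + g).
Proof.
move=> ff fg; apply: (@fin_supp_sub _ ([set t | f t != 0] `|` [set t | g t != 0])).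
  by rewrite finite_setU.
move=> t; apply: contra_neqP => /not_orP[/= /negP/negPn/eqP ft /negP/negPn/eqP gt].
by rewrite !fctE /= ft gt scaler0 addr0.
Qed.

Lemma fsum_finite (A : set T) (F : T -> R) : finite_set A ->
  (forall t, F t != 0 -> A t) ->
  \sum_(t \in [set: T]) F t = \sum_(t <- fset_set A) F t.
Proof.
move=> fA FA; apply: fsbigTE => t; rewrite in_fset_set // => /negP tA.
by apply/eqP; apply: contraT => /FA At; case: tA; rewrite inE.
Qed.

Lemma fdotC f g : fdot f g = fdot g f.
Proof. by apply: eq_fsbigr => t _; rewrite mulrC. Qed.

Lemma fdot_lin a f g h : fin_supp f -> fin_supp g ->
  fdot (a *: f + g) h = a * fdot f h + fdot g h.
Proof.
move=> ff fg; pose A := [set t | f t != 0] `|` [set t | g t != 0].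
have fA : finite_set A by rewrite finite_setU.
rewrite /fdot !(@fsum_finite A) //; first last.
- move=> t; apply: contra_neqP => /not_orP[/= /negP/negPn/eqP ft /negP/negPn/eqP gt].
  by rewrite !fctE /= ft gt scaler0 addr0 mul0r.
- by move=> t ft; left; apply: contra_neq ft => ->; rewrite mul0r.
- by move=> t ft; right; apply: contra_neq ft => ->; rewrite mul0r.
rewrite mulr_sumr -big_split; apply: eq_bigr => t _ /=.
by rewrite !fctE /= mulrDl -mulrA.
Qed.

(** The finite support of [h] already makes all sums finite, so [f] and [g] may be pullbacks to the
    infinite covering. *)
Lemma fdot_linr a f g h : fin_supp h ->
  fdot h (a *: f + g) = a * fdot h f + fdot h g.
Proof.
move=> fh; rewrite /fdot !(@fsum_finite _ _ fh) //.
- rewrite mulr_sumr -big_split; apply: eq_bigr => t _ /=.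
  by rewrite !fctE /= mulrDr mulrCA.
- by move=> t; apply: contra_neq => ->; rewrite mul0r.
- by move=> t; apply: contra_neq => ->; rewrite mul0r.
- by move=> t; apply: contra_neq => ->; rewrite mul0r.
Qed.

Lemma fdot_ge0 f : 0 <= fdot f f.
Proof. by apply: fsumr_ge0 => t _; rewrite -expr2 sqr_ge0. Qed.

Lemma fdot_eq0 f : fin_supp f -> fdot f f = 0 -> f = 0.
Proof.
move=> ff; rewrite /fdot (@fsum_finite _ _ ff) => [|t]; last first.
  by apply: contra_neq => ->; rewrite mul0r.
move=> /eqP; rewrite psumr_eq0 => [/allP f0|t _]; last by rewrite -expr2 sqr_ge0.
apply/funext => t; apply/eqP; apply: contraT => ft.
have := f0 t; rewrite in_fset_set // mem_set // mulf_eq0 orbb.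
by rewrite (negPf ft) => /(_ isT).
Qed.

Lemma fdot_inner_product (P : set (T -> R^o)) : lin_subspace P ->
  P `<=` fin_supp -> inner_product P fdot.
Proof.
move=> sP Pfin; split=> [|f g|a f g h /Pfin ff /Pfin fg _|f|f /Pfin].
- exact: sP.
- exact: fdotC.
- exact: fdot_lin.
- exact: fdot_ge0.
- exact: fdot_eq0.
Qed.

End FiniteSupport.

(** Cauchy-Schwarz against the constant 1, by Lagrange's identity. *)
Lemma sqr_sum_le (R : realType) (I : Type) (r : seq I) (x : I -> R) :
  (\sum_(i <- r) x i) ^+ 2 <= (size r)%:R * \sum_(i <- r) x i ^+ 2.
Proof.
have sumc (c : R) : \sum_(i <- r) c = (size r)%:R * c.
  by rewrite big_const_seq count_predT iter_addr_0 mulr_natl.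
set S := \sum_(i <- r) x i; set Q := \sum_(i <- r) _.
suff : 0 <= 2 * ((size r)%:R * Q - S ^+ 2) by lra.
have -> : 2 * ((size r)%:R * Q - S ^+ 2) =
    \sum_(i <- r) \sum_(j <- r) (x i - x j) ^+ 2.
  under eq_bigr => i _.
    under eq_bigr => j _ do rewrite sqrrB -mulr_natl.
    rewrite !big_split /= sumc sumrN -mulr_sumr -mulr_sumr -/S -/Q.
    rewrite (_ : _ + _ = (size r)%:R * x i ^+ 2 - 2 * S * x i + Q); last by ring.
    over.
  rewrite !big_split /= sumc sumrN -!mulr_sumr -/S -/Q; ring.
by apply: sumr_ge0 => i _; apply: sumr_ge0 => j _; rewrite sqr_ge0.
Qed.

(** * Tuples of vertices *)

Section Tuples.
Variable V : choiceType.

Definition perm_tuple n (s : 'S_n) (t : n.-tuple V) : n.-tuple V :=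
  [tuple tnth t (s i) | i < n].

Lemma perm_tupleK n (s : 'S_n) : cancel (@perm_tuple n s) (perm_tuple s^-1%g).
Proof.
by move=> t; apply: eq_from_tnth => i; rewrite !tnth_mktuple permKV.
Qed.

Lemma perm_tuple_bij n (s : 'S_n) : bijective (@perm_tuple n s).
Proof.
exists (perm_tuple s^-1%g); first exact: perm_tupleK.
by move=> t; rewrite -{1}[s]invgK perm_tupleK.
Qed.

Lemma perm_eq_perm_tuple n (s : 'S_n) (t : n.-tuple V) :
  perm_eq (perm_tuple s t) t.
Proof. by apply/tuple_permP; exists s. Qed.

Lemma tuple_face_sub n (t : n.+1.-tuple V) i v : v \in tuple_face t i -> v \in t.
Proof. by move=> /tnthP[k ->]; rewrite tnth_mktuple mem_tnth. Qed.

Lemma tuple_face_cons n (v : V) (t : n.-tuple V) :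
  tuple_face [tuple of v :: t] ord0 = t.
Proof.
by apply: eq_from_tnth => j; rewrite tnth_mktuple tnthS.
Qed.

Lemma perm_tuple_cons n (v : V) (t : n.-tuple V) (s : 'S_n) :
  [tuple of v :: perm_tuple s t] =
  perm_tuple (lift_perm ord0 ord0 s) [tuple of v :: t].
Proof.
apply: eq_from_tnth => i; rewrite tnth_mktuple.
case: (unliftP ord0 i) => [j ->|->].
  by rewrite lift_perm_lift !tnthS tnth_mktuple.
by rewrite lift_perm_id !tnth0.
Qed.

(** The cycle bringing entry [i] to the front; its sign is that of the [i]-th face in the
    coboundary, so the two cancel on alternating functions. *)
Definition front_perm n (i : 'I_n.+1) : 'S_n.+1 := lift_perm ord0 i 1%g.

Lemma odd_front_perm n (i : 'I_n.+1) : front_perm i = odd i :> bool.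
Proof. by rewrite odd_lift_perm odd_perm1 addbF. Qed.

Lemma perm_tuple_front n (i : 'I_n.+1) (t : n.+1.-tuple V) :
  perm_tuple (front_perm i) t = [tuple of tnth t i :: tuple_face t i].
Proof.
apply: eq_from_tnth => k; rewrite tnth_mktuple.
case: (unliftP ord0 k) => [j ->|->].
  by rewrite lift_perm_lift perm1 tnthS tnth_mktuple.
by rewrite lift_perm_id tnth0.
Qed.

(** Deleting position [i] and its image from [s] leaves a permutation. It relates the faces of a
    permuted tuple to permuted faces, and [odd_lift_perm] then tracks the signs. *)
Lemma lift_perm_ex n (s : 'S_n.+1) i : exists s' : 'S_n, s = lift_perm i (s i) s'.
Proof.
pose f j := odflt j (unlift (s i) (s (lift i j))).
have fE j : s (lift i j) = lift (s i) (f j).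
  rewrite /f; case: unliftP => [k //|/perm_inj/eqP].
  by rewrite eq_sym (negPf (neq_lift _ _)).
have f_inj : injective f.
  by move=> j k e; apply: (@lift_inj _ i); apply: (@perm_inj _ s); rewrite !fE e.
exists (perm f_inj); apply/permP => k; case: (unliftP i k) => [j ->|->].
  by rewrite lift_perm_lift permE fE.
by rewrite lift_perm_id.
Qed.

Lemma tuple_face_perm n (s : 'S_n.+1) (r : 'S_n) i (t : n.+1.-tuple V) :
  s = lift_perm i (s i) r ->
  tuple_face (perm_tuple s t) i = perm_tuple r (tuple_face t (s i)).
Proof.
move=> sE; apply: eq_from_tnth => j; rewrite !tnth_mktuple.
by rewrite {1}sE lift_perm_lift.
Qed.

Definition cons_pair n (x : n.-tuple V * V) : n.+1.-tuple V := [tuple of x.2 :: x.1].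

Lemma cons_pair_bij n : bijective (@cons_pair n).
Proof.
exists (fun t => (behead_tuple t, thead t)) => [[t v]|t] /=.
  by rewrite /cons_pair /= theadE; congr (_, _); exact: val_inj.
by rewrite [RHS]tuple_eta /cons_pair /=; exact: val_inj.
Qed.

Lemma fsum_cons (R : realType) n (F : n.+1.-tuple V -> R) :
  finite_set [set t | F t != 0] ->
  \sum_(t \in [set: n.+1.-tuple V]) F t =
  \sum_(t \in [set: n.-tuple V]) \sum_(v \in [set: V]) F [tuple of v :: t].
Proof.
move=> fF; rewrite (reindex_fsbigT _ _ (cons_pair_bij n)).
(* The support lies in the finite box of its tails [A] and heads [B], on which the order of
   summation is free. *)
pose A := [set behead_tuple t | t in [set t | F t != 0]].
pose B := [set thead t | t in [set t | F t != 0]].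
have fA : finite_set A by exact: finite_image.
have fB : finite_set B by exact: finite_image.
have FAB (t : n.-tuple V) v : F [tuple of v :: t] != 0 -> A t /\ B v.
  by move=> F0; split; exists [tuple of v :: t] => //; exact: val_inj.
rewrite -(fsbig_widen (A `*` B)) //; last first.
  move=> [t v] [_ /= nAB]; apply/eqP; apply: contraT => /FAB AB.
  by case: nAB.
rewrite -(pair_fsbig _ (fun (t : n.-tuple V) v => F [tuple of v :: t])) //.
rewrite (fsbig_widen A setT) //; last first.
  move=> t [_ At] /=; apply: fsbig1 => v _; apply/eqP.
  by apply: contraT => /FAB[].
apply: eq_fsbigr => t _; apply: fsbig_widen => // v [_ Bv] /=; apply/eqP.
by apply: contraT => /FAB[].
Qed.

End Tuples.

(** * The Laplacian of a complex of bounded degree *)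

Section Laplacian.
Variables (R : realType) (V : choiceType) (K : scomplex V).

Local Notation cochain n := (@cochain R V K n).

Lemma spans_perm n (s : 'S_n) (t : n.-tuple V) :
  spans_simplex K (perm_tuple s t) <-> spans_simplex K t.
Proof.
have pst := perm_eq_perm_tuple s t; rewrite /spans_simplex (perm_uniq pst).
suff -> : [fset v in (perm_tuple s t : seq V)]%fset = [fset v in (t : seq V)]%fset by [].
by apply/fsetP => v; rewrite !inE (perm_mem pst).
Qed.

Lemma spans_sub n m (t : n.+1.-tuple V) (u : m.-tuple V) :
  spans_simplex K u -> uniq t -> {subset t <= u} -> spans_simplex K t.
Proof.
move=> [_ Ku] ut tu; split=> //; apply: (simplex_face Ku).
  by apply/fsubsetP => v; rewrite !inE; exact: tu.
move=> /fsetP/(_ (thead t)); rewrite !inE => /negP; apply.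
exact: mem_tnth.
Qed.

Lemma spans_face n (t : n.+2.-tuple V) i :
  spans_simplex K t -> spans_simplex K (tuple_face t i).
Proof.
move=> st; apply: (spans_sub st); last by move=> v; exact: tuple_face_sub.
have /tuple_uniqP inj_t := st.1; apply/tuple_uniqP => j k.
by rewrite !tnth_mktuple => /inj_t; exact: lift_inj.
Qed.

Lemma spans_behead n (v : V) (t : n.+1.-tuple V) :
  spans_simplex K [tuple of v :: t] -> spans_simplex K t.
Proof. by move=> /(@spans_face _ _ ord0); rewrite tuple_face_cons. Qed.

Lemma spans_vertex n (t : n.-tuple V) v : spans_simplex K t -> v \in t ->
  K [fset v]%fset.
Proof.
move=> [_ Kt] vt; apply: (simplex_face Kt).
  by apply/fsubsetP => w; rewrite !inE => /eqP ->.
by move=> /fsetP/(_ v); rewrite !inE eqxx.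
Qed.

Lemma spans_nil (t : 0.-tuple V) : ~ spans_simplex K t.
Proof.
move=> [_ /simplex_neq0]; apply; apply/fsetP => v; rewrite !inE.
by case: t => -[].
Qed.

Lemma cochain_spans n f (t : n.-tuple V) : cochain n f -> f t != 0 ->
  spans_simplex K t.
Proof.
move=> [f0 _] /eqP ft; apply: contrapT => /f0; exact: ft.
Qed.

Lemma cochain_perm n f (s : 'S_n) t : cochain n f ->
  f (perm_tuple s t) = (-1) ^+ s * f t.
Proof. by move=> [_ fs]; rewrite fs. Qed.

Lemma cochain_subspace n : lin_subspace (cochain n).
Proof.
split=> [|a f g cf cg]; first by split=> [//|s t]; rewrite mulr0.
split=> [t nt|s t]; rewrite !fctE /=.
  by rewrite (proj1 cf _ nt) (proj1 cg _ nt) scaler0 addr0.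
rewrite -/(perm_tuple s t) (cochain_perm s t cf) (cochain_perm s t cg) mulrDr.
by rewrite /GRing.scale /= mulrCA.
Qed.

Lemma cochain0 (f : 0.-tuple V -> R^o) t : cochain 0 f -> f t = 0.
Proof. by move=> [f0 _]; apply: f0; exact: spans_nil. Qed.

Lemma coboundary_cochain n f : cochain n f -> cochain n.+1 (coboundary K f).
Proof.
move=> cf; split=> [t nt|s t]; rewrite -?/(perm_tuple s t) /coboundary.
  by rewrite asboolF.
have [st|st] := pselect (spans_simplex K t); last first.
  by rewrite !asboolF ?mulr0 // => /spans_perm.
rewrite !asboolT ?spans_perm // mulr_sumr [RHS](reindex_inj (@perm_inj _ s)) /=.
apply: eq_bigr => i _; have [r sE] := lift_perm_ex s i.
rewrite (tuple_face_perm _ sE) (cochain_perm r _ cf) !mulrA; congr (_ * _).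
(* Equivalently (-1)^i sgn r = sgn s (-1)^(s i), which matches the two sums term by term. *)
have sO : s = odd i (+) odd (s i) (+) r :> bool by rewrite {1}sE odd_lift_perm.
rewrite -(signr_odd _ i) -(signr_odd _ (s i)) -!signr_addb sO.
by case: (odd i) (odd (s i)) (r : bool) => [] [] [].
Qed.

Lemma cocoboundary_cochain n g : cochain n.+1 g -> cochain n (cocoboundary K g).
Proof.
move=> cg; split=> [t nt|s t]; rewrite -?/(perm_tuple s t) /cocoboundary.
  by rewrite asboolF.
have [st|st] := pselect (spans_simplex K t); last first.
  by rewrite !asboolF ?mulr0 // => /spans_perm.
rewrite !asboolT ?spans_perm // mulr_fsumr; apply: eq_fsbigr => v _.
by rewrite perm_tuple_cons (cochain_perm _ _ cg) odd_lift_perm.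
Qed.

Lemma laplacian_cochain q f : cochain q.+1 f -> cochain q.+1 (laplacian K f).
Proof.
move=> cf; apply: lin_subspaceD; first exact: cochain_subspace.
  exact/cocoboundary_cochain/coboundary_cochain.
exact/coboundary_cochain/cocoboundary_cochain.
Qed.

(** Links are bounded for nonempty tuples only, since every vertex extends the empty one. The
    containing finite set [A] states finiteness and the bound together. *)
Definition bounded_degree (D : nat) : Prop :=
  forall n (t : n.+1.-tuple V), spans_simplex K t ->
  exists2 A : {fset V}, (#|` A| <= D)%N &
    forall v, spans_simplex K [tuple of v :: t] -> v \in A.

Variable (D : nat).
Hypothesis degK : bounded_degree D.

Definition insert_at n (i : 'I_n.+1) (t : n.-tuple V) (v : V) : n.+1.-tuple V :=
  [tuple if unlift i k is Some j then tnth t j else v | k < n.+1].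

Lemma insert_atK n (t : n.+1.-tuple V) i :
  insert_at i (tuple_face t i) (tnth t i) = t.
Proof.
apply: eq_from_tnth => k; rewrite tnth_mktuple; case: unliftP => [j|] ->//.
by rewrite tnth_mktuple.
Qed.

(** Such a tuple arises by inserting, at one of finitely many places, a vertex of the finite link of
    one of the finitely many tuples in the support of [f]. *)
Lemma finite_cofaces n (f : n.-tuple V -> R^o) : cochain n f -> fin_supp f ->
  finite_set [set t : n.+1.-tuple V |
    spans_simplex K t /\ exists i, f (tuple_face t i) != 0].
Proof.
case: n f => [|n] f cf ff.
  rewrite (_ : [set _ | _] = set0) //; apply/seteqP; split=> // t [_ [i]].
  by rewrite cochain0 ?eqxx.
pose link (t : n.+1.-tuple V) := [set v | spans_simplex K [tuple of v :: t]].
pose E := \bigcup_(i in [set: 'I_n.+2]) \bigcup_(t in [set t | f t != 0])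
  [set insert_at i t v | v in link t].
apply: (@sub_finite_set _ _ E) => [t [st [i fi]]|].
  exists i => //; exists (tuple_face t i) => //.
  exists (tnth t i); last exact: insert_atK.
  by rewrite /link /= -perm_tuple_front spans_perm.
apply: bigcup_finite => [|i _]; first exact: finite_finset.
apply: bigcup_finite => // t /(cochain_spans cf) st; apply: finite_image.
have [A _ tA] := degK st.
by apply: sub_finite_set (finite_fset A) => v /tA.
Qed.

Definition fin_cochain n : set (n.-tuple V -> R^o) :=
  [set f | cochain n f /\ fin_supp f].

Lemma fin_cochain_subspace n : lin_subspace (@fin_cochain n).
Proof.
split=> [|a f g [cf ff] [cg fg]].
  split; first exact: (lin_subspace0 (cochain_subspace n)).
  rewrite /fin_supp (_ : [set _ | _] = set0) //.
  by apply/seteqP; split=> // t; rewrite /= eqxx.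
split; first exact: (lin_subspaceP (cochain_subspace n)).
exact: fin_suppP.
Qed.

Lemma fin_cochain_ip n : inner_product (@fin_cochain n) (@fdot R _).
Proof. by apply: fdot_inner_product => [|f []//]; exact: fin_cochain_subspace. Qed.

Lemma coboundary_fin n f : @fin_cochain n f -> fin_cochain (coboundary K f).
Proof.
move=> [cf ff]; have cdf := coboundary_cochain cf.
split=> //; apply: fin_supp_sub (finite_cofaces cf ff) _ => t dft.
split; first exact: cochain_spans dft.
apply: contrapT => /forallNP f0; move: dft; rewrite /coboundary.
rewrite big1 ?if_same ?eqxx // => i _; apply/eqP; rewrite mulf_eq0.
by apply/orP; right; apply: contraT => /f0.
Qed.

Lemma cocoboundary_neq0 n (g : n.+1.-tuple V -> R^o) t :
  cocoboundary K g t != 0 ->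
  spans_simplex K t /\ exists v, g [tuple of v :: t] != 0.
Proof.
rewrite /cocoboundary; case: asboolP => [st|]; last by rewrite eqxx.
move=> h; split=> //; apply: contrapT => /forallNP g0; move: h.
by rewrite fsbig1 ?eqxx // => v _; apply/eqP; apply: contraT => /g0.
Qed.

Lemma cocoboundary_fin n g : @fin_cochain n.+1 g -> fin_cochain (cocoboundary K g).
Proof.
move=> [cg fg]; split; first exact: cocoboundary_cochain.
apply: fin_supp_sub (finite_image (fun t : n.+1.-tuple V => behead_tuple t) fg) _.
move=> t /cocoboundary_neq0[_ [v gv]]; exists [tuple of v :: t] => //.
exact: val_inj.
Qed.

Lemma laplacian_fin q f : @fin_cochain q.+1 f -> fin_cochain (laplacian K f).
Proof.
move=> cf; apply: lin_subspaceD; first exact: fin_cochain_subspace.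
  exact/cocoboundary_fin/coboundary_fin.
exact/coboundary_fin/cocoboundary_fin.
Qed.

Lemma coboundary_lin n a (f g : n.-tuple V -> R^o) :
  coboundary K (a *: f + g) = a *: coboundary K f + coboundary K g.
Proof.
apply/funext => t; rewrite !fctE /= /coboundary; case: asboolP => _.
  rewrite scaler_sumr -big_split; apply: eq_bigr => i _ /=.
  by rewrite mulrDr scalerAr.
by rewrite scaler0 addr0.
Qed.

Lemma cocoboundary_lin n a (f g : n.+1.-tuple V -> R^o) :
  fin_supp f -> fin_supp g ->
  cocoboundary K (a *: f + g) = a *: cocoboundary K f + cocoboundary K g.
Proof.
move=> ff fg; apply/funext => t; rewrite !fctE /= /cocoboundary.
case: asboolP => _; last by rewrite scaler0 addr0.
pose A := [set thead u | u in [set u | f u != 0] `|` [set u | g u != 0]].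
have fA : finite_set A by apply: finite_image; rewrite finite_setU.
rewrite !(@fsum_finite _ _ A) //; first last.
- move=> v h; exists [tuple of v :: t]; last by rewrite theadE.
  apply: contra_neqP h => /not_orP[/= /negP/negPn/eqP ft /negP/negPn/eqP gt].
  by rewrite ft gt scaler0 addr0.
- by move=> v h; exists [tuple of v :: t]; [left|rewrite theadE].
- by move=> v h; exists [tuple of v :: t]; [right|rewrite theadE].
by rewrite scaler_sumr -big_split; apply: eq_bigr.
Qed.

Lemma laplacian_lin q a (f g : q.+1.-tuple V -> R^o) :
  fin_cochain f -> fin_cochain g ->
  laplacian K (a *: f + g) = a *: laplacian K f + laplacian K g.
Proof.
move=> cf cg; rewrite /laplacian coboundary_lin !cocoboundary_lin ?coboundary_lin.
- by rewrite scalerDr addrACA.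
- exact: cf.2.
- exact: cg.2.
- exact: (coboundary_fin cf).2.
- exact: (coboundary_fin cg).2.
Qed.

(* Alternation makes all the n + 1 terms of the coboundary contribute equally. *)
Lemma coboundary_adjoint n (f : n.-tuple V -> R^o) (g : n.+1.-tuple V -> R^o) :
    cochain n f -> cochain n.+1 g -> fin_supp f \/ fin_supp g ->
  fdot (coboundary K f) g = n.+1%:R * fdot f (cocoboundary K g).
Proof.
move=> cf cg fin.
(* All nonzero terms are indexed by [H], which is finite as soon as one of [f] and [g] is finitely
   supported. *)
pose H := [set t | g t != 0 /\ exists i, f (tuple_face t i) != 0].
have fH : finite_set H.
  case: fin => [ff|fg]; last by apply: sub_finite_set fg => t [].
  apply: sub_finite_set (finite_cofaces cf ff) => t [gt ft]; split=> //.
  exact: cochain_spans gt.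
have inH t i : f (tuple_face t i) * g t != 0 -> H t.
  by rewrite mulf_eq0 negb_or => /andP[ft gt]; split=> //; exists i.
have -> : fdot (coboundary K f) g = \sum_(t \in [set: n.+1.-tuple V])
    \sum_(i < n.+1) (-1) ^+ i * (f (tuple_face t i) * g t).
  apply: eq_fsbigr => t _; rewrite /coboundary; case: asboolP => st.
    by rewrite mulr_suml; apply: eq_bigr => i _; rewrite mulrA.
  rewrite (proj1 cg _ st) mulr0 big1 // => i _; by rewrite !mulr0.
rewrite (@fsum_finite _ _ H) //; last first.
  move=> t; apply: contra_neqP => nH; rewrite big1 // => i _.
  apply/eqP; rewrite mulf_eq0; apply/orP; right.
  by apply: contraT => /inH.
rewrite exchange_big /=.
have termE (i : 'I_n.+1) : \sum_(t <- fset_set H) (-1) ^+ i * (f (tuple_face t i) * g t) =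
    fdot f (cocoboundary K g).
  rewrite -(@fsum_finite _ _ H) //; last first.
    by move=> t h; apply: (inH t i); apply: contra_neq h => ->; rewrite mulr0.
  transitivity (\sum_(t \in [set: n.+1.-tuple V]) (f (tuple_face t ord0) * g t)).
    rewrite [RHS](reindex_fsbigT _ _ (perm_tuple_bij V (front_perm i))).
    apply: eq_fsbigr => t _; rewrite (cochain_perm _ t cg) odd_front_perm signr_odd.
    by rewrite perm_tuple_front tuple_face_cons mulrCA.
  rewrite fsum_cons; last by apply: sub_finite_set fH => t; exact: inH.
  apply: eq_fsbigr => t _.
  under eq_fsbigr => v _ do rewrite tuple_face_cons.
  rewrite -mulr_fsumr /cocoboundary; case: asboolP => // st.
  by rewrite (proj1 cf _ st) !mul0r.
by under eq_bigr do rewrite termE; rewrite sumr_const card_ord mulr_natl.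
Qed.

End Laplacian.

(** * Bounds for the Laplacian and the spectral gap as an inequality of forms *)

Section Spectrum.
Variables (R : realType) (V : choiceType) (K : scomplex V) (D : nat).
Hypotheses (degK : bounded_degree K D) (D0 : (0 < D)%N).

Local Notation cochain n := (@cochain R V K n).
Local Notation fin_cochain n := (@fin_cochain R V K n).

(** Cauchy-Schwarz over the at most [D] vertices that extend a given tuple, summed over the
    tuples. *)
Lemma cocoboundary_bound n (g : n.+1.-tuple V -> R^o) : fin_cochain n.+1 g ->
  fdot (cocoboundary K g) (cocoboundary K g) <= D%:R * fdot g g.
Proof.
move=> [cg fg]; pose B := [set behead_tuple t | t in [set t | g t != 0]].
have fB : finite_set B by exact: finite_image.
have gB (t : n.-tuple V) v : g [tuple of v :: t] != 0 -> B t.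
  by move=> gt; exists [tuple of v :: t] => //; exact: val_inj.
rewrite {1}/fdot (@fsum_finite _ _ B) // => [|t h]; last first.
  suff /cocoboundary_neq0[_ [v /gB]] : cocoboundary K g t != 0 by [].
  by apply: contra_neq h => ->; rewrite mul0r.
rewrite /fdot fsum_cons; last first.
  by apply: sub_finite_set fg => t /=; apply: contra_neq => ->; rewrite mul0r.
rewrite (@fsum_finite _ _ B) // => [|t h]; last first.
  apply: contrapT => Bt; move/eqP: h; apply; apply: fsbig1 => v _.
  suff -> : g [tuple of v :: t] = 0 by rewrite mul0r.
  by apply/eqP; apply: contraT => /gB.
rewrite mulr_sumr; apply: ler_sum => t _.
have sq0 : 0 <= \sum_(v \in [set: V]) g [tuple of v :: t] * g [tuple of v :: t].
  by apply: fsumr_ge0 => v _; rewrite -expr2 sqr_ge0.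
rewrite {1 2}/cocoboundary; case: asboolP => st; last by rewrite mul0r mulr_ge0.
case: n => [|n] in g cg fg B fB gB t st sq0 *; first by have := spans_nil st.
have [A AD tA] := degK st.
have gA v : v \notin A -> g [tuple of v :: t] = 0.
  move=> vA; apply: (proj1 cg) => /tA; exact/negP.
rewrite !(fsbigTE A) => [|v /gA ->|v /gA ->]; rewrite ?mul0r // -expr2.
apply: le_trans (sqr_sum_le _ _) _; apply: ler_pM => //.
- by apply: sumr_ge0 => v _; rewrite sqr_ge0.
- by rewrite ler_nat.
Qed.

(** Passes the previous bound to the adjoint. With w the cocoboundary of df and s = (n + 1) D,
    adjointness gives |df|^2 = (n + 1) <f, w>, so |w|^2 <= D |df|^2 = s <f, w>; expanding |s f -
    w|^2 >= 0 then yields <f, w> <= s |f|^2. *)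
Lemma coboundary_bound n (f : n.-tuple V -> R^o) : fin_cochain n f ->
  fdot (coboundary K f) (coboundary K f) <= (n.+1%:R ^+ 2 * D%:R) * fdot f f.
Proof.
move=> ff; have fdf := coboundary_fin degK ff; have fw := cocoboundary_fin fdf.
have ip := fin_cochain_ip R K n; set df := coboundary K f in fdf fw *.
set w := cocoboundary K df in fw.
have xE : fdot df df = n.+1%:R * fdot f w.
  by apply: (coboundary_adjoint degK ff.1 fdf.1); left; exact: ff.2.
pose s : R := n.+1%:R * D%:R.
have : 0 <= fdot (s *: f - w) (s *: f - w) by exact: fdot_ge0.
have fsf : fin_cochain n (s *: f) by apply: lin_subspaceZ => //; exact: fin_cochain_subspace.
have fsw : fin_cochain n (s *: f - w) by apply: lin_subspaceB => //; exact: fin_cochain_subspace.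
rewrite (dotBl ip) // !(dotBr ip) // !(dotZl ip) // !(dotZr ip) // (dotC ip w f).
have := cocoboundary_bound fdf; rewrite -/w xE.
have d0 : 0 < D%:R :> R by rewrite ltr0n.
have n0 : 0 < n.+1%:R :> R by rewrite ltr0n.
rewrite /s; set d := D%:R in d0 *; set m := n.+1%:R in n0 *.
move: (fdot f f) (fdot f w) (fdot w w) => y z x h1 h2.
rewrite -(ler_pM2l d0); lra.
Qed.

(** The two weights undo the factors of [coboundary_adjoint] in degrees q + 1 and q. The cochain [f]
    may have infinite support, as pullbacks do. *)
Lemma laplacian_dotl q (u f : q.+1.-tuple V -> R^o) :
    fin_cochain q.+1 u -> cochain q.+1 f ->
  fdot (laplacian K u) f =
    q.+2%:R^-1 * fdot (coboundary K u) (coboundary K f) +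
    q.+1%:R * fdot (cocoboundary K u) (cocoboundary K f).
Proof.
move=> fu cf; have fdu := coboundary_fin degK fu; have fwu := cocoboundary_fin fu.
rewrite /laplacian -[X in X + _]scale1r fdot_lin; first last.
- exact: (coboundary_fin degK fwu).2.
- exact: (cocoboundary_fin fdu).2.
rewrite mul1r (coboundary_adjoint degK fwu.1 cf); last by left; exact: fwu.2.
rewrite [fdot (coboundary K u) _]fdotC.
rewrite (coboundary_adjoint degK cf fdu.1); last by right; exact: fdu.2.
by rewrite mulKf ?pnatr_eq0 // [fdot f _]fdotC.
Qed.

Lemma laplacian_dotr q (u f : q.+1.-tuple V -> R^o) :
    fin_cochain q.+1 u -> cochain q.+1 f ->
  fdot (laplacian K u) f = fdot u (laplacian K f).
Proof.
move=> fu cf; rewrite laplacian_dotl //.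
have cdf := coboundary_cochain cf; have cwf := cocoboundary_cochain cf.
rewrite /laplacian -[X in fdot u (X + _)]scale1r fdot_linr; last exact: fu.2.
rewrite mul1r [fdot u (coboundary K _)]fdotC (coboundary_adjoint degK cwf fu.1); last first.
  by right; exact: fu.2.
rewrite (coboundary_adjoint degK fu.1 cdf); last by left; exact: fu.2.
by rewrite mulKf ?pnatr_eq0 // [fdot (cocoboundary K f) _]fdotC.
Qed.

Lemma laplacian_symmetric q :
  symmetric_op (fin_cochain q.+1) (@fdot R _) (laplacian K (q:=q)).
Proof.
split=> [u|a u v|u v fu [cv _]].
- exact: (laplacian_fin degK).
- exact: (laplacian_lin degK).
- exact: laplacian_dotr.
Qed.

Lemma laplacian_form_ge0 q (u : q.+1.-tuple V -> R^o) : fin_cochain q.+1 u ->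
  0 <= fdot (laplacian K u) u.
Proof.
move=> fu; rewrite laplacian_dotl //; last exact: fu.1.
by rewrite addr_ge0 // mulr_ge0 ?fdot_ge0 ?invr_ge0.
Qed.

Lemma laplacian_form_le q (u : q.+1.-tuple V -> R^o) : fin_cochain q.+1 u ->
  fdot (laplacian K u) u <= ((q.+2%:R + q.+1%:R) * D%:R) * fdot u u.
Proof.
move=> fu; rewrite laplacian_dotl //; last exact: fu.1.
rewrite [leRHS](_ : _ = q.+2%:R * D%:R * fdot u u + q.+1%:R * D%:R * fdot u u); last first.
  by set a := q.+2%:R; set b := q.+1%:R; ring.
apply: lerD.
  rewrite mulrC ler_pdivrMr ?ltr0n //; apply: le_trans (coboundary_bound fu) _.
  set a := q.+2%:R; rewrite [leRHS](_ : _ = a ^+ 2 * D%:R * fdot u u) //; ring.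
by rewrite -mulrA ler_pM2l ?ltr0n //; exact: cocoboundary_bound.
Qed.

Lemma sqnorm_fin n (f : n.-tuple V -> R^o) : fin_supp f ->
  sqnorm f = (n`!%:R^-1 * fdot f f)%:E.
Proof.
move=> ff; rewrite /sqnorm EFinM; congr (_ * _)%E.
pose A := [set t | f t != 0].
transitivity (\esum_(t in A) ((f t : R) ^+ 2)%:E)%E.
  rewrite [RHS]esum_mkcond; apply: eq_esum => t _.
  case: ifPn => // /negP; rewrite inE /A /= => /negP/negPn/eqP ->.
  by rewrite expr0n.
rewrite esum_fset // => [|t _]; last by rewrite lee_fin sqr_ge0.
rewrite fsumEFin // (fsbig_widen A setT) //.
by move=> t [_ /negP/negPn/eqP ft] /=; rewrite ft expr0n.
Qed.

(** A number below [l0] lies in the resolvent set, and the estimate this provides, restricted to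
    finitely supported cochains, is the hypothesis of [form_ge_of_resolvent]. The factorials of
    [sqnorm] cancel. *)
Lemma laplacian_gap q l0 : 0 <= l0 ->
    (forall mu : R, laplacian_spectrum K q mu -> l0 <= mu) ->
  forall u, fin_cochain q.+1 u -> l0 * fdot u u <= fdot (laplacian K u) u.
Proof.
move=> l00 gap; have symL := laplacian_symmetric q.
have ip := fin_cochain_ip R K q.+1.
apply: (form_ge_of_resolvent ip symL (K := (q.+2%:R + q.+1%:R) * D%:R)) => //.
- by rewrite mulr_gt0 ?ltr0n // addr_gt0 ?ltr0n.
- exact: laplacian_form_ge0.
- exact: laplacian_form_le.
move=> mu mul0; have [[_ [M HM]]|/gap] := pselect (laplacian_resolvent K q mu); last first.
  by rewrite leNgt mul0.
exists M => u fu.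
have fT : fin_cochain q.+1 (laplacian K u - mu *: u).
  have sF := fin_cochain_subspace R K q.+1.
  by apply: lin_subspaceB => //; [exact: (laplacian_fin degK)|exact: lin_subspaceZ].
have l2u : l2_cochain K u by split; [exact: fu.1|rewrite sqnorm_fin ?ltry //; exact: fu.2].
have := HM _ l2u; rewrite !sqnorm_fin; [|exact: fT.2|exact: fu.2].
rewrite -EFinM lee_fin mulrCA ler_pM2l // invr_gt0 ltr0n; exact: fact_gt0.
Qed.

(** Testing the orthogonality on b = [cocoboundary K u] gives |b|^2 = 0 by adjointness. *)
Lemma harmonic q (u : q.+1.-tuple V -> R^o) : fin_cochain q.+1 u ->
    coboundary K u = 0 ->
    (forall b, fin_cochain q b -> fdot u (coboundary K b) = 0) ->
  laplacian K u = 0.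
Proof.
move=> fu du0 ub; have fwu := cocoboundary_fin fu.
have wu0 : cocoboundary K u = 0.
  apply: fdot_eq0 fwu.2 _; have := ub _ fwu.
  rewrite fdotC (coboundary_adjoint degK fwu.1 fu.1); last by left; exact: fwu.2.
  by move=> /eqP; rewrite mulf_eq0 pnatr_eq0 /= => /eqP.
apply/funext => t; rewrite /laplacian du0 wu0 !fctE /= /cocoboundary /coboundary.
rewrite fsbig1 // big1 => [|i _]; last by rewrite mulr0.
by rewrite !if_same addr0.
Qed.

End Spectrum.

(** * Word metrics *)

Lemma least_spec (P : set nat) n : P n -> P (least P) /\ (least P <= n)%N.
Proof.
move=> Pn; rewrite /least; case: xgetP => [m _ [Pm minm]|none].
  by split=> //; exact: minm.
have exP : exists n, `[< P n >] by exists n; exact/asboolP.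
have [m /asboolP Pm minm] := ex_minnP exP.
by case: (none m); split=> // k Pk; apply: minm; exact/asboolP.
Qed.

Lemma card_fset_set_le (T : choiceType) (A B : set T) :
  A `<=` B -> finite_set B -> (#|` fset_set A| <= #|` fset_set B|)%N.
Proof.
move=> AB fB; apply: fsubset_leq_card; rewrite -fset_set_sub //.
exact: sub_finite_set fB.
Qed.

Lemma card_fset_set_image (T U : choiceType) (f : T -> U) (A : set T) :
  finite_set A -> (#|` fset_set (f @` A)| <= #|` fset_set A|)%N.
Proof. by move=> fA; rewrite fset_set_image // leq_imfset_card. Qed.

Lemma card_fset_set_setX (T U : choiceType) (A : set T) (B : set U) :
  finite_set A -> finite_set B ->
  (#|` fset_set (A `*` B)| <= #|` fset_set A| * #|` fset_set B|)%N.
Proof.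
move=> fA fB; rewrite -(size_allpairs pair); apply: uniq_leq_size => [//|[x y]].
rewrite fset_setX // in_fsetM => /andP[xA yB].
by apply/allpairsP; exists (x, y).
Qed.

Section WordMetric.
Variables (G : groupType) (S : {fset G}).
Hypothesis genS : generates S.
Local Open Scope group_scope.
Local Notation len := (word_length S).

Lemma word_length_spells g : exists2 w, spells S w g & size w = len g.
Proof.
have [w wg] := genS g.
by have [] := @least_spec [set n | exists2 w, spells S w g & size w = n]
  (size w) (ex_intro2 _ _ w wg erefl).
Qed.

Lemma word_length_le w g : spells S w g -> (len g <= size w)%N.
Proof.
move=> wg; by have [] := @least_spec
  [set n | exists2 w, spells S w g & size w = n] (size w) (ex_intro2 _ _ w wg erefl).
Qed.

Lemma foldr_mulg_cat (w w' : seq G) :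
  foldr (fun x y => x * y) 1 (w ++ w') =
  foldr (fun x y => x * y) 1 w * foldr (fun x y => x * y) 1 w'.
Proof. by elim: w => [|x w IH] /=; rewrite ?mul1g // IH mulgA. Qed.

Lemma word_length_mul g h : (len (g * h) <= len g + len h)%N.
Proof.
have [w [Sw <-] <-] := word_length_spells g.
have [w' [Sw' <-] <-] := word_length_spells h.
rewrite -size_cat; apply: word_length_le; split; last exact: foldr_mulg_cat.
by move=> x; rewrite mem_cat => /orP[/Sw|/Sw'].
Qed.

Lemma word_length_inv g : (len g^-1 <= len g)%N.
Proof.
have [w [Sw <-] <-] := word_length_spells g.
rewrite -(size_rev w) -(size_map (fun x => x^-1)); apply: word_length_le; split.
  move=> x /mapP[y]; rewrite mem_rev => /Sw yS ->; rewrite invgK.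
  by case: yS; [right|left].
elim: w {Sw} => [|x w IH] /=; first by rewrite invg1.
by rewrite rev_cons map_rcons -cats1 foldr_mulg_cat IH /= mulg1 invgM.
Qed.

Lemma word_length1 : len 1 = 0%N.
Proof. by apply/eqP; rewrite -leqn0; apply: (@word_length_le [::]). Qed.

Lemma word_length_eq0 g : len g = 0%N -> g = 1.
Proof. by have [w [_ <-] <-] := word_length_spells g; case: w. Qed.

(** Each ball lies in the product of the alphabet with the previous ball. Finiteness is carried
    through the induction because [fset_set] counts only finite sets correctly. *)
Lemma vol_le (R : realType) (n : nat) (r : R) : (r <= n%:R)%R ->
  (vol S r <= ((#|` S|).*2.+1) ^ n)%N.
Proof.
(* The extra letter 1 takes care of the empty word, which has no first letter to split off. *)
pose A : {fset G} := (1 |` (S `|` [fset x^-1 | x in S]))%fset.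
have cardA : (#|` A| <= (#|` S|).*2.+1)%N.
  rewrite /A cardfsU1; apply: (@leq_trans (1 + (#|` S| + #|` S|))).
    apply: leq_add; first by case: (_ \notin _).
    rewrite (leq_trans (leq_card_fsetU _ _)) // leq_add2l.
    exact: leq_imfset_card.
  by rewrite addnn.
pose B n := [set g | (len g <= n)%N].
suff {r} H k : finite_set (B k) /\ (#|` fset_set (B k)| <= ((#|` S|).*2.+1) ^ k)%N.
  move=> rn; apply: leq_trans _ (H n).2; apply: card_fset_set_le; last exact: (H n).1.
  move=> g; rewrite /word_ball /B /= => gr.
  by rewrite -(ler_nat R); exact: le_trans gr rn.
elim: k => [|k [fB IH]].
  have -> : B 0%N = [set 1].
    apply/seteqP; split=> [g|_ ->]; rewrite /B /=; last by rewrite word_length1.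
    by rewrite leqn0 => /eqP/word_length_eq0.
  by rewrite fset_set1 cardfs1; split => //; exact: finite_set1.
pose f (p : G * G) := p.1 * p.2.
have sub : B k.+1 `<=` f @` ([set` A] `*` B k).
  move=> g; rewrite /B /=; have [w [Sw <-] <-] := word_length_spells g.
  case: w Sw => [|x w] Sw sw.
    by exists (1, 1); rewrite /f /= ?mulg1 // !inE eqxx word_length1.
  exists (x, foldr (fun x y => x * y) 1 w) => //=; split.
    rewrite !inE; case: (Sw x (mem_head _ _)) => xS; first by rewrite xS orbT.
    apply/orP; right; apply/orP; right; apply/imfsetP; exists x^-1 => //.
    by rewrite invgK.
  apply: leq_trans (word_length_le (w := w) _) sw; split=> // y yw.
  by apply: Sw; rewrite inE yw orbT.
have fX : finite_set ([set` A] `*` B k) by exact: finite_setX.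
split; first by apply: sub_finite_set sub _; exact: finite_image.
apply: leq_trans (card_fset_set_le sub (finite_image _ fX)) _.
apply: leq_trans (card_fset_set_image _ fX) _.
apply: leq_trans (card_fset_set_setX _ _) _ => //.
by rewrite set_fsetK expnS leq_mul.
Qed.

Section NormalSubgroup.
Variable H : set G.
Hypotheses (nH : normal_subgroup H) (iH : finite_index H).

Lemma subgroupM g h : H g -> H h -> H (g * h).
Proof.
case: nH => H1 HV _ Hg Hh; rewrite -[h]invgK; apply: (HV) => //.
by rewrite -[h^-1]mul1g; apply: HV.
Qed.

Lemma subgroupV g : H g -> H g^-1.
Proof. by case: nH => H1 HV _ Hg; rewrite -[g^-1]mul1g; exact: HV. Qed.

Lemma subgroup1 : H 1. Proof. by case: nH. Qed.

Lemma subgroup_index_gt0 : (0 < subgroup_index H)%N.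
Proof.
rewrite cardfs_gt0; apply/eqP => /(fset_set_set0 iH) c0.
have : cosets H [set (1 * h) | h in H] by exists 1.
by rewrite c0.
Qed.

Lemma short_le h : H h -> h <> 1 -> (short S H <= len h)%N.
Proof.
move=> Hh h1; pose P := [set n | exists g, [/\ H g, g <> 1 & len g = n]].
by have [] := @least_spec P (len h) (ex_intro _ h (And3 Hh h1 erefl)).
Qed.

End NormalSubgroup.
End WordMetric.

(** From idx <= M^(C l) one gets l >= ln idx / (C ln M), so a power of rho with exponent about l / c
    is at most a negative power of idx. *)
Lemma exp_decay_powR (R : realType) (rho : R) (M C c N0 : nat) :
    0 < rho < 1 -> (1 < M)%N -> (0 < C)%N -> (0 < c)%N ->
  exists A beta : R, [/\ 0 < A, beta < 1 &
    forall m N idx l : nat, (0 < idx)%N -> (idx <= M ^ (C * l))%N ->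
      (N <= N0 * idx)%N -> m%:R <= N%:R * rho ^+ (l %/ c) ->
      m%:R < A * idx%:R `^ beta].
Proof.
move=> /andP[r0 r1] M1 C0 c0.
have lnr : ln rho < 0 by rewrite ln_lt0 // r0.
have lnM : 0 < ln M%:R :> R by rewrite ln_gt0 // ltr1n.
(* The exponent for which rho^(l / c) = idx^(-d) when idx = M^(C l). *)
pose d := - ln rho / (c%:R * C%:R * ln M%:R).
have den0 : 0 < c%:R * C%:R * ln M%:R :> R by rewrite !mulr_gt0 ?ltr0n.
have d0 : 0 < d by rewrite divr_gt0 // oppr_gt0.
(* Division by rho pays for rounding down in l %/ c; adding 1 makes the final inequality strict. *)
exists (N0%:R / rho + 1), (1 - d); split.
- by rewrite ltr_wpDl // divr_ge0 // ltW.
- by rewrite ltrBlDr ltrDl.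
move=> m N idx l i0 iM NN0 mN.
have idx0 : 0 < idx%:R :> R by rewrite ltr0n.
set j := (l %/ c)%N in mN.
have lj : (l <= c * j.+1)%N by rewrite mulnC ltnW // ltn_ceil.
have key : rho ^+ j <= rho^-1 * idx%:R `^ (- d).
  rewrite -ler_pdivrMl ?invr_gt0 // invrK -exprS.
  rewrite -ler_ln ?posrE ?exprn_gt0 ?powR_gt0 // ln_powR lnXn //.
  rewrite -[ln rho *+ _]mulr_natr [- d * _]mulNr lerNr -mulNr /d -[leLHS]mulrA.
  rewrite ler_pM2l ?oppr_gt0 // mulrC ler_pdivrMr //.
  apply: (@le_trans _ _ (ln ((M ^ (C * l))%:R : R))).
    by rewrite ler_ln ?posrE ?ltr0n ?ler_nat // expn_gt0 (ltnW M1).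
  rewrite natrX lnXn ?ltr0n ?(ltnW M1) // -[leLHS]mulr_natr mulrC.
  rewrite [leRHS]mulrA ler_pM2r // -!natrM ler_nat mulnA mulnC [(j.+1 * c)%N]mulnC.
  by rewrite leq_mul2r lj orbT.
apply: le_lt_trans mN _.
apply: (@le_lt_trans _ _ (N0%:R / rho * idx%:R `^ (1 - d))).
  rewrite powRD ?idx0 ?(gt_eqF idx0) ?implybT // powRr1 ?ler0n //.
  have -> : N0%:R / rho * (idx%:R * idx%:R `^ (- d)) =
    (N0 * idx)%:R * (rho^-1 * idx%:R `^ (- d)) by rewrite natrM; ring.
  by apply: ler_pM => //; [exact/exprn_ge0/ltW|rewrite ler_nat].
by rewrite ltr_pM2r ?powR_gt0 // ltrDl.
Qed.

(** * Lifting along the covering *)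

Lemma mem_fset_seq (T : choiceType) (s : seq T) v :
  (v \in [fset x in s]%fset) = (v \in s).
Proof. by rewrite !inE. Qed.

Lemma fset_map_tuple (T U : choiceType) (f : T -> U) n (t : n.-tuple T) :
  [fset v in (map_tuple f t : seq U)]%fset =
  [fset f w | w in [fset v in (t : seq T)]]%fset.
Proof.
apply/fsetP => v; rewrite mem_fset_seq; apply/mapP/imfsetP => -[w /=].
  by move=> ws ->; exists w; rewrite //= mem_fset_seq.
by rewrite mem_fset_seq => ws ->; exists w.
Qed.

Lemma imfset1 (T U : choiceType) (f : T -> U) x :
  [fset f w | w in [fset x]]%fset = [fset f x]%fset.
Proof.
apply/fsetP => v; rewrite !inE; apply/imfsetP/eqP => [[w /=]|->].
  by rewrite inE => /eqP -> ->.
by exists x; rewrite //= inE.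
Qed.

(** Counts along a total relation instead of a function, because the lifts through which tuples are
    compared are only known to exist. *)
Lemma card_rel_le (T U : choiceType) (A : set T) (B : set U) (r : T -> U -> Prop) :
    finite_set B -> (forall a, A a -> exists2 b, B b & r a b) ->
    (forall a a' b, A a -> A a' -> r a b -> r a' b -> a = a') ->
  finite_set A /\ (#|` fset_set A| <= #|` fset_set B|)%N.
Proof.
move=> fB tot inj; have [A0|] := eqVneq A set0.
  by rewrite A0 fset_set0 cardfs0.
move=> /set0P[a0 /tot[b0 _ _]].
pose f a := xget b0 [set b | B b /\ r a b].
have fP a : A a -> B (f a) /\ r a (f a).
  move=> /tot[b Bb rb]; rewrite /f; case: xgetP => [_ _ //|none].
  by case: (none b).
have injf : {in A &, injective f}.
  move=> a a' /[!inE] Aa Aa' e; apply: (inj _ _ (f a)) => //; first exact: (fP _ Aa).2.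
  by rewrite e; exact: (fP _ Aa').2.
have subB : f @` A `<=` B by move=> _ [a Aa <-]; exact: (fP _ Aa).1.
have fA : finite_set A.
  apply: card_le_finite (sub_finite_set subB fB).
  by rewrite -(card_le_eql (inj_card_eq injf)) card_lexx.
split=> //; have <- : #|` (f @` fset_set A)%fset| = #|` fset_set A|.
  by rewrite card_in_imfset // => a a' /=; rewrite !in_fset_set //; exact: injf.
by rewrite -fset_set_image //; exact: card_fset_set_le.
Qed.

Lemma finite_choose_bound (T : choiceType) (A : set T) (P : T -> nat -> Prop) :
    finite_set A -> (forall a, A a -> exists n, P a n) ->
    (forall a n m, (n <= m)%N -> P a n -> P a m) ->
  exists n, forall a, A a -> P a n.
Proof.
move=> fA exP mono.
have /choice[f fP] : forall a, exists n, A a -> P a n.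
  by move=> a; have [/exP[n Pn]|nA] := pselect (A a); [exists n|exists 0%N].
exists (\max_(a <- fset_set A) f a)%N => a Aa; apply: mono (fP a Aa).
by apply: leq_bigmax_seq => //; rewrite in_fset_set // inE.
Qed.

Lemma finite_tuples (T : choiceType) (A : set T) n : finite_set A ->
  finite_set [set t : n.-tuple T | forall v, v \in t -> A v].
Proof.
move=> fA; elim: n => [|n IH].
  apply: (@sub_finite_set _ _ [set [tuple]]); last exact: finite_set1.
  by move=> t _; rewrite /= tuple0.
pose f (x : T * n.-tuple T) := [tuple of x.1 :: x.2].
apply: sub_finite_set (finite_image f (finite_setX fA IH)) => t At.
exists (thead t, behead_tuple t) => /=; last by rewrite /f /= [RHS]tuple_eta.
split; first by apply: At; exact: mem_tnth.
by move=> v /mem_behead /At.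
Qed.

Definition spanning_tuples (U : choiceType) (K : scomplex U) (n : nat) :
  set (n.-tuple U) := [set t | spans_simplex K t].
Arguments spanning_tuples {U} K n.

Section Covering.
Variables (G : groupType) (V W : choiceType).
Variables (X : scomplex V) (Y : scomplex W) (p : W -> V) (act : G -> W -> W).
Hypotheses (X_finite : finite_set (simplex X)).
Hypotheses (cov : regular_covering act Y X p).

Local Notation mapt f t := (map_tuple f t).

Lemma act1 w : act 1%g w = w. Proof. by case: cov => _ []. Qed.

Lemma actM g h w : act (g * h)%g w = act g (act h w).
Proof. by case: cov => _ []. Qed.

Lemma actK g : cancel (act g) (act g^-1%g).
Proof. by move=> w; rewrite -actM mulVg act1. Qed.

Lemma act_inj g : injective (act g).
Proof. exact: can_inj (actK g). Qed.

Lemma act_vertex g w : Y [fset w]%fset -> Y [fset act g w]%fset.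
Proof. by case: cov => _ _ sa _ _ Yw; rewrite -imfset1; exact: sa. Qed.

Lemma act_free g w : Y [fset w]%fset -> act g w = w -> g = 1%g.
Proof.
by case: cov => _ _ _ fa _ Yw e; apply: (fa _ _ Yw); rewrite imfset1 e.
Qed.

Lemma proj_act g w : Y [fset w]%fset -> p (act g w) = p w.
Proof.
move=> Yw; case: cov => _ _ _ _ reg; apply/esym.
by apply/(reg _ _ Yw (act_vertex g Yw)); exists g.
Qed.

Lemma proj_eq w w' : Y [fset w]%fset -> Y [fset w']%fset -> p w = p w' ->
  exists g, w' = act g w.
Proof. by move=> Yw Yw'; case: cov => _ _ _ _ reg /(reg _ _ Yw Yw'). Qed.

Lemma act_spans g n (t : n.-tuple W) : spans_simplex Y t ->
  spans_simplex Y (mapt (act g) t).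
Proof.
case=> ut Yt; split; first by rewrite map_inj_uniq //; exact: act_inj.
by rewrite fset_map_tuple; case: cov => _ _ sa _ _; exact: sa.
Qed.

Lemma proj_spans n (t : n.-tuple W) : spans_simplex Y t ->
  spans_simplex X (mapt p t).
Proof.
case=> ut Yt; case: cov => -[im inj _ _] _ _ _ _; split.
  by rewrite map_inj_in_uniq // => w w' wt wt'; apply: (inj _ Yt); rewrite mem_fset_seq.
by rewrite fset_map_tuple; exact: im.
Qed.

(** The simplices underlying [t] and [t'] contain a common vertex and lie over the same simplex of
    [X], so the covering property makes them equal; [p] is injective on this simplex. *)
Lemma unique_lift n (t t' : n.-tuple W) k :
    spans_simplex Y t -> spans_simplex Y t' -> mapt p t = mapt p t' ->
  tnth t k = tnth t' k -> t = t'.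
Proof.
move=> st st' ptt' e; have sx := proj_spans st.
case: cov => -[_ inj _ lift] _ _ _ _.
have Yk := spans_vertex st (mem_tnth k t).
have pk : p (tnth t k) \in [fset v in (mapt p t : seq V)]%fset.
  by rewrite mem_fset_seq; apply: map_f; exact: mem_tnth.
have [s [_ us]] := lift _ _ Yk sx.2 pk.
have s1 : s = [fset v in (t : seq W)]%fset.
  by apply: us; split; [exact: st.2|by rewrite mem_fset_seq mem_tnth|by rewrite fset_map_tuple].
have s2 : s = [fset v in (t' : seq W)]%fset.
  apply: us; split; [exact: st'.2|by rewrite mem_fset_seq e mem_tnth|].
  by rewrite -fset_map_tuple ptt'.
apply: eq_from_tnth => i; apply: (inj _ st.2).
- by rewrite mem_fset_seq mem_tnth.
- by rewrite -s1 s2 mem_fset_seq mem_tnth.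
- by have := congr1 (fun x => tnth x i) ptt'; rewrite !tnth_map.
Qed.

Definition vertices : set V := [set v | X [fset v]%fset].

Lemma finite_vertices : finite_set vertices.
Proof.
apply: (finite_preimage (f := fun v => [fset v]%fset) _ X_finite) => v v' _ _.
exact: fset1_inj.
Qed.

Lemma finite_spanning_base n : finite_set (spanning_tuples X n).
Proof.
apply: sub_finite_set (@finite_tuples _ vertices n finite_vertices) => t st v vt.
exact: spans_vertex st vt.
Qed.

(** By [unique_lift] the projection is injective on the link of [t], so the vertices of [X] bound
    its size. The successor makes the bound positive. *)
Lemma bounded_degree_cover : bounded_degree Y #|` fset_set vertices|.+1.
Proof.
move=> n t st; pose A := [set v | spans_simplex Y [tuple of v :: t]].
have vA v : A v -> vertices (p v).
  move=> /proj_spans sv; apply: (spans_vertex sv); exact: mem_head.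
have [] := @card_rel_le _ _ A vertices (fun v x => p v = x) finite_vertices.
- by move=> v /vA; exists (p v).
- move=> v v' x Av Av' <- pv.
  have /(congr1 val)[] // : [tuple of v :: t] = [tuple of v' :: t].
  apply: (unique_lift (k := lift ord0 ord0)) => //; last by rewrite !tnthS.
  by apply: val_inj; rewrite /= pv.
move=> fA cA; exists (fset_set A); first exact: leqW.
by move=> v sv; rewrite in_fset_set // inE.
Qed.

Section Coordinates.
Variable S : {fset G}.

(* The group coordinate of a vertex relative to a fundamental domain; adjacent
   pairs of vertices fall into finitely many orbits. *)
Lemma group_coordinate : exists (gam : W -> G) (C : nat),
  [/\ (0 < C)%N, forall g w, Y [fset w]%fset -> gam (act g w) = (g * gam w)%g
    & forall w w', spans_simplex Y [tuple w; w'] ->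
        (word_length S ((gam w)^-1 * gam w')%g <= C)%N].
Proof.
(* A default vertex is needed to choose orbit representatives; if [W] is empty the claim is
   vacuous. *)
have [[w0 _]|noW] := pselect (exists w : W, True); last first.
  exists (fun=> 1%g), 1%N; split=> // [g w|w]; by case: noW; exists w.
pose rep v := xget w0 [set w | Y [fset w]%fset /\ p w = v].
have repP w : Y [fset w]%fset -> Y [fset rep (p w)]%fset /\ p (rep (p w)) = p w.
  move=> Yw; rewrite /rep; case: xgetP => [_ _ //|none].
  by case: (none w).
pose gam w := xget 1%g [set g | w = act g (rep (p w))].
have gamP w : Y [fset w]%fset -> w = act (gam w) (rep (p w)).
  move=> Yw; have [Yr pr] := repP _ Yw.
  rewrite {1}/gam; case: xgetP => [_ _ //|none].
  by have [g wE] := proj_eq Yr Yw pr; case: (none g).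
have gamM g w : Y [fset w]%fset -> gam (act g w) = (g * gam w)%g.
  move=> Yw; have [Yr _] := repP _ Yw; have Ygw := act_vertex g Yw.
  have e := gamP _ Ygw; rewrite proj_act // {1}(gamP _ Yw) -actM in e.
  apply/(mulgI (gam (act g w))^-1%g); rewrite mulVg; apply/esym.
  by apply: (act_free Yr); rewrite actM e actK.
(* The element (gam w)^-1 gam w' is invariant under the action, and edges over the same ordered pair
   differ by a group element, so one value is attached to each of finitely many pairs. *)
exists gam; pose Q (x : V * V) n := forall w w', spans_simplex Y [tuple w; w'] ->
  p w = x.1 -> p w' = x.2 -> (word_length S ((gam w)^-1 * gam w')%g <= n)%N.
have [||C QC] := @finite_choose_bound _ (vertices `*` vertices) Q
    (finite_setX finite_vertices finite_vertices).
- move=> [a b] _; have [[[w w'] [sw [/= pa pb]]]|none] := pselect (exists x : W * W,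
    spans_simplex Y [tuple x.1; x.2] /\ (p x.1 = a /\ p x.2 = b)); last first.
    by exists 0%N => w w' sw /= pa pb; case: none; exists (w, w').
  exists (word_length S ((gam w)^-1 * gam w')%g) => w1 w1' sw1 /= pa1 pb1.
  have vert x x' : spans_simplex Y [tuple x; x'] ->
      Y [fset x]%fset /\ Y [fset x']%fset.
    by move=> sx; split; apply: (spans_vertex sx); rewrite !inE eqxx ?orbT.
  have [Yw Yw'] := vert _ _ sw; have [Yw1 Yw1'] := vert _ _ sw1.
  have [g w1E] : exists g, w1 = act g w by apply: proj_eq => //; rewrite pa.
  have /(congr1 val) [_ w1E'] : [tuple w1; w1'] = mapt (act g) [tuple w; w'].
    apply: (unique_lift (k := ord0)) => //; first exact: act_spans.
    by apply: val_inj; rewrite /= !proj_act // pa1 pb1 pa pb.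
  by rewrite w1E w1E' !gamM // invgM -mulgA mulKg.
- by move=> x n m nm Qn w w' sw pw pw'; apply: leq_trans (Qn _ _ sw pw pw') nm.
exists C.+1; split=> // w w' sw; apply: leqW; apply: (QC (p w, p w')) => //=.
by split; apply: (spans_vertex (proj_spans sw)); rewrite !inE eqxx ?orbT.
Qed.

End Coordinates.
End Covering.

(** * The finite quotients *)

Section Quotient.
Variables (G : groupType) (V W : choiceType).
Variables (X : scomplex V) (Y : scomplex W) (p : W -> V) (act : G -> W -> W).
Hypotheses (X_finite : finite_set (simplex X)).
Hypotheses (cov : regular_covering act Y X p).
Variables (H : set G).
Hypotheses (nH : normal_subgroup H) (iH : finite_index H).

Local Notation Q := (quotient_complex act H Y).
Local Notation pi := (orbit_map act H).
Local Notation mapt f t := (map_tuple f t).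

Lemma orbit_mapP w w' : pi w = pi w' -> exists2 h, H h & w' = act h w.
Proof.
move=> e; have : pi w' w'.
  by exists 1%g; [exact: subgroup1 nH|exact: (act1 cov)].
by rewrite -e => -[h Hh <-]; exists h.
Qed.

Lemma orbit_map_act h w : H h -> pi (act h w) = pi w.
Proof.
move=> Hh; apply/seteqP; split=> _ [k Hk <-].
  by exists (k * h)%g; [exact: subgroupM|rewrite (actM cov)].
exists (k * h^-1)%g; first by apply: subgroupM => //; exact: subgroupV.
by rewrite -(actM cov) mulgVK.
Qed.

Lemma orbit_map_proj w w' : Y [fset w]%fset -> pi w = pi w' -> p w = p w'.
Proof. by move=> Yw /orbit_mapP[h _ ->]; rewrite (proj_act cov). Qed.

Lemma mapt_proj_orbit n (t t' : n.-tuple W) : spans_simplex Y t ->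
  mapt pi t = mapt pi t' -> mapt p t = mapt p t'.
Proof.
move=> st e; apply: eq_from_tnth => i; rewrite !tnth_map.
apply: orbit_map_proj; first exact: spans_vertex st (mem_tnth _ _).
by have := congr1 (fun x => tnth x i) e; rewrite !tnth_map.
Qed.

Lemma orbit_spans n (t : n.-tuple W) : spans_simplex Y t ->
  spans_simplex Q (mapt pi t).
Proof.
move=> st; split; last first.
  by rewrite fset_map_tuple; exists [fset v in (t : seq W)]%fset => //; exact: st.2.
rewrite map_inj_in_uniq ?st.1 // => w w' wt wt' /orbit_map_proj pw.
case: (cov) => -[_ inj _ _] _ _ _ _; apply: (inj _ st.2).
- by rewrite mem_fset_seq.
- by rewrite mem_fset_seq.
- by apply: pw; exact: spans_vertex st wt.
Qed.

(** All entries are lifted inside one simplex over the given one, so the lifts span a face of it. *)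
Lemma orbit_lift n (s : n.-tuple (set W)) : spans_simplex Q s ->
  exists2 t : n.-tuple W, spans_simplex Y t & mapt pi t = s.
Proof.
case: n s => [|n] s ss; first by have := spans_nil ss.
case: (ss) => us [s0 Ys0 im].
have /choice[f fP] : forall i, exists w, w \in s0 /\ pi w = tnth s i.
  move=> i; have : tnth s i \in [fset v in (s : seq (set W))]%fset.
    by rewrite mem_fset_seq mem_tnth.
  by rewrite -im => /imfsetP[w /= ws ->]; exists w.
have e : mapt pi [tuple f i | i < n.+1] = s.
  by apply: eq_from_tnth => i; rewrite tnth_map tnth_mktuple; exact: (fP i).2.
exists [tuple f i | i < n.+1] => //; split.
  by apply: (@map_uniq _ _ pi); have := congr1 val e => /= ->.
apply: (simplex_face Ys0).
  apply/fsubsetP => w; rewrite mem_fset_seq => /tnthP[i ->].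
  by rewrite tnth_mktuple; exact: (fP i).1.
move=> /fsetP/(_ (f ord0)); rewrite mem_fset_seq inE => /negP; apply.
by apply/tnthP; exists ord0; rewrite tnth_mktuple.
Qed.

Lemma mapt_cons (T U : Type) (f : T -> U) n v (t : n.-tuple T) :
  mapt f [tuple of v :: t] = [tuple of f v :: mapt f t].
Proof. exact: val_inj. Qed.

(** Some lift of the extended tuple exists; its tail and [t] differ by an element of [H], by unique
    lifting, and translating by this element moves the new vertex into the link of [t]. With
    [link_inj], [pi] is a bijection of links. *)
Lemma link_lift n (t : n.+1.-tuple W) a : spans_simplex Y t ->
    spans_simplex Q [tuple of a :: mapt pi t] ->
  exists2 v, spans_simplex Y [tuple of v :: t] & pi v = a.
Proof.
move=> st /orbit_lift[t']; rewrite [t']tuple_eta.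
set v' := thead t'; set u := behead_tuple t' => st' e.
have su := spans_behead st'.
have eu : mapt pi u = mapt pi t.
  by apply: eq_from_tnth => i; have := congr1 (fun x => tnth x (lift ord0 i)) e;
    rewrite mapt_cons !tnthS.
have ev : pi v' = a.
  by have := congr1 (fun x => tnth x ord0) e; rewrite mapt_cons !tnth0.
have [h Hh th] : exists2 h, H h & tnth t ord0 = act h (tnth u ord0).
  by apply: orbit_mapP; have := congr1 (fun x => tnth x ord0) eu; rewrite !tnth_map.
have ut : mapt (act h) u = t.
  apply: (unique_lift cov (k := ord0)) => //; first exact: (act_spans cov).
    rewrite -(mapt_proj_orbit su eu); apply: eq_from_tnth => i; rewrite !tnth_map.
    by rewrite (proj_act cov) //; exact: spans_vertex su (mem_tnth _ _).
  by rewrite tnth_map.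
exists (act h v'); last by rewrite orbit_map_act.
by rewrite -ut -mapt_cons; exact: (act_spans cov).
Qed.

Lemma link_inj n (t : n.+1.-tuple W) v v' :
    spans_simplex Y [tuple of v :: t] -> spans_simplex Y [tuple of v' :: t] ->
  pi v = pi v' -> v = v'.
Proof.
move=> sv sv' e; have /(congr1 val)[] // : [tuple of v :: t] = [tuple of v' :: t].
apply: (unique_lift cov (k := lift ord0 ord0)) => //; last by rewrite !tnthS.
by apply: mapt_proj_orbit => //; rewrite !mapt_cons e.
Qed.

Lemma bounded_degree_quotient D : bounded_degree Y D -> bounded_degree Q D.
Proof.
move=> degY n s ss; have [t st ts] := orbit_lift ss; have [A AD tA] := degY _ _ st.
exists [fset pi v | v in A]%fset; first by rewrite (leq_trans (leq_imfset_card _ _ _)).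
rewrite -ts => a /(link_lift st)[v sv <-]; apply/imfsetP; exists v => //=.
exact: tA.
Qed.

Section Coordinate.
Variables (S : {fset G}) (gam : W -> G) (C : nat).
Hypothesis genS : generates S.
Hypothesis gamM : forall g w, Y [fset w]%fset -> gam (act g w) = (g * gam w)%g.
Hypothesis gamC : forall w w', spans_simplex Y [tuple w; w'] ->
  (word_length S ((gam w)^-1 * gam w')%g <= C)%N.
Local Notation len := (word_length S).

(* A spanning tuple of the quotient is determined by its image in X and the
   coset of the coordinate of the first vertex of a lift. *)
Lemma card_spanning_quotient n :
  finite_set (spanning_tuples Q n.+1) /\
  (#|` fset_set (spanning_tuples Q n.+1)| <=
    #|` fset_set (spanning_tuples X n.+1)| * subgroup_index H)%N.
Proof.
pose r (s : n.+1.-tuple (set W)) (b : n.+1.-tuple V * set G) := exists t,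
  [/\ spans_simplex Y t, mapt pi t = s, mapt p t = b.1
    & [set (gam (tnth t ord0) * h)%g | h in H] = b.2].
have fX := finite_spanning_base X_finite n.+1.
have [||fQ cQ] := @card_rel_le _ _ (spanning_tuples Q n.+1)
    (spanning_tuples X n.+1 `*` cosets H) r (finite_setX fX iH).
- move=> s /orbit_lift[t st ts].
  exists (mapt p t, [set (gam (tnth t ord0) * h)%g | h in H]); last by exists t.
  by split; [exact: (proj_spans cov)|exists (gam (tnth t ord0))].
- move=> _ _ [x c] _ _ [t [st <- /= px <-]] [t' [st' <- /= px' ec]].
  have Yt i : Y [fset tnth t i]%fset by exact: spans_vertex st (mem_tnth _ _).
  have Yt' i : Y [fset tnth t' i]%fset by exact: spans_vertex st' (mem_tnth _ _).
  have p0 : p (tnth t ord0) = p (tnth t' ord0).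
    by have := congr1 (fun x => tnth x ord0) px; rewrite -px' !tnth_map.
  have [g t'g] := proj_eq cov (Yt _) (Yt' _) p0.
  (* Equality of cosets puts g in a conjugate of [H], which is [H] by normality. *)
  have Hg : H g.
    have : [set (gam (tnth t ord0) * h)%g | h in H] (gam (tnth t' ord0)).
      by rewrite -ec; exists 1%g; [exact: subgroup1 nH|rewrite mulg1].
    rewrite t'g gamM // => -[h Hh e].
    have -> : g = (gam (tnth t ord0) * h * (gam (tnth t ord0))^-1)%g by rewrite e mulgK.
    case: nH => _ _ /(_ (gam (tnth t ord0))^-1%g h Hh).
    by rewrite invgK mulgA.
  have tt' : mapt (act g) t = t'.
    apply: (unique_lift cov (k := ord0)) => //; first exact: (act_spans cov).
      rewrite px' -px; apply: eq_from_tnth => i; rewrite !tnth_map.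
      by rewrite (proj_act cov).
    by rewrite tnth_map.
  rewrite -tt'; apply: eq_from_tnth => i; rewrite !tnth_map.
  by rewrite orbit_map_act.
by split=> //; apply: leq_trans cQ _; exact: card_fset_set_setX.
Qed.

Lemma finite_spanning_quotient n : finite_set (spanning_tuples Q n).
Proof.
case: n => [|n]; last by have [] := card_spanning_quotient n.
rewrite (_ : spanning_tuples _ _ = set0) //; apply/seteqP; split=> // t.
exact: spans_nil.
Qed.

(** Distance is read off group coordinates rather than edge paths, so that it compares directly with
    [short]. *)
Definition within_radius (g : G) (r : nat) (t : seq W) : Prop :=
  forall w, w \in t -> (len (g^-1 * gam w)%g <= r)%N.

Lemma adjacent_coordinate n (t : n.-tuple W) w w' : spans_simplex Y t ->
  w \in t -> w' \in t -> (len ((gam w)^-1 * gam w')%g <= C)%N.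
Proof.
move=> st wt wt'; have [->|ww'] := eqVneq w w'; first by rewrite mulVg word_length1.
apply: gamC; apply: (spans_sub st); first by rewrite /= inE ww'.
by move=> x; rewrite !inE => /orP[]/eqP ->.
Qed.

Lemma near_adjacent n (t : n.-tuple W) g r w w' : spans_simplex Y t ->
  w \in t -> w' \in t -> (len (g^-1 * gam w)%g <= r)%N ->
  (len (g^-1 * gam w')%g <= r + C)%N.
Proof.
move=> st wt wt' wr.
have -> : (g^-1 * gam w' = (g^-1 * gam w) * ((gam w)^-1 * gam w'))%g.
  by rewrite mulgA mulgK.
apply: leq_trans (word_length_mul genS _ _) _.
by apply: leq_add => //; exact: adjacent_coordinate st wt wt'.
Qed.

(** If h <> 1 in [H] carried a vertex of [t] with coordinate a to the corresponding one of [t'],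
    then a^-1 h a, which lies in [H] by normality, would be a nontrivial element of length at most 2
    r. *)
Lemma near_orbit_inj n (t t' : n.-tuple W) g r : (r + r < short S H)%N ->
    spans_simplex Y t -> within_radius g r t -> within_radius g r t' ->
  mapt pi t = mapt pi t' -> t = t'.
Proof.
move=> rs st nt nt' e; apply: eq_from_tnth => i.
have [h Hh t'h] : exists2 h, H h & tnth t' i = act h (tnth t i).
  by apply: orbit_mapP; have := congr1 (fun x => tnth x i) e; rewrite !tnth_map.
have [h1|h1] := pselect (h = 1%g); first by rewrite t'h h1 (act1 cov).
have Yt : Y [fset tnth t i]%fset by exact: spans_vertex st (mem_tnth _ _).
set a := gam (tnth t i); have ga : gam (tnth t' i) = (h * a)%g by rewrite t'h gamM.
have Hk : H (a^-1 * (h * a))%g by case: nH => _ _; exact.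
have k1 : (a^-1 * (h * a))%g <> 1%g.
  move=> k1; apply: h1; apply: (mulIg a); rewrite mul1g; apply: (mulgI a^-1%g).
  by rewrite k1 mulVg.
suff : (short S H <= r + r)%N by rewrite leqNgt rs.
apply: leq_trans (short_le S Hk k1) _.
have -> : (a^-1 * (h * a) = (g^-1 * a)^-1 * (g^-1 * (h * a)))%g.
  by rewrite invgM invgK !mulgA mulgK.
apply: leq_trans (word_length_mul genS _ _) _; apply: leq_add.
  by apply: leq_trans (word_length_inv genS _) _; apply: nt; exact: mem_tnth.
by rewrite -ga; apply: nt'; exact: mem_tnth.
Qed.

Variable (R : realType).

Lemma coboundary_near n (f : n.-tuple W -> R^o) g r : cochain Y f ->
    (forall t, f t != 0 -> within_radius g r t) ->
  forall t, coboundary Y f t != 0 -> within_radius g (r + C) t.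
Proof.
move=> cf fr t dft; have st := cochain_spans (coboundary_cochain cf) dft.
have [i fi] : exists i, f (tuple_face t i) != 0.
  apply: contrapT => /forallNP f0; move: dft; rewrite /coboundary.
  rewrite big1 ?if_same ?eqxx // => i _; apply/eqP; rewrite mulf_eq0.
  by apply/orP; right; apply: contraT => /f0.
case: n => [|n] in f cf fr t dft st i fi *; first by move: fi; rewrite (cochain0 _ cf) eqxx.
move=> w wt; apply: (near_adjacent (w := tnth (tuple_face t i) ord0) st) => //.
  by apply: (@tuple_face_sub _ _ _ i); exact: mem_tnth.
by apply: (fr _ fi); exact: mem_tnth.
Qed.

Lemma cocoboundary_near n (f : n.+1.-tuple W -> R^o) g r :
    (forall t, f t != 0 -> within_radius g r t) ->
  forall t, cocoboundary Y f t != 0 -> within_radius g r t.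
Proof.
move=> fr t /cocoboundary_neq0[_ [v fv]] w wt.
by apply: (fr _ fv); rewrite inE wt orbT.
Qed.

(** Passing to a subtuple does not enlarge the radius, and either term of the Laplacian contains a
    single coboundary, hence a single [C]. *)
Lemma laplacian_near q (f : q.+1.-tuple W -> R^o) g r : cochain Y f ->
    (forall t, f t != 0 -> within_radius g r t) ->
  forall t, laplacian Y f t != 0 -> within_radius g (r + C) t.
Proof.
move=> cf fr t; rewrite /laplacian fctE /=.
have [->|ne _] := eqVneq (cocoboundary Y (coboundary Y f) t) 0.
  rewrite add0r; apply: coboundary_near; first exact: cocoboundary_cochain.
  exact: cocoboundary_near.
by apply: cocoboundary_near ne => u; exact: coboundary_near.
Qed.

Lemma iter_near q (f : q.+1.-tuple W -> R^o) g r a b j : cochain Y f ->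
    (forall t, f t != 0 -> within_radius g r t) ->
  cochain Y (iter j (fun u => a *: u + b *: laplacian Y u) f) /\
  forall t, iter j (fun u => a *: u + b *: laplacian Y u) f t != 0 ->
    within_radius g (r + j * C) t.
Proof.
move=> cf fr; elim: j => [|j [cu ur]] /=; first by rewrite mul0n addn0.
set u := iter j _ f in cu ur *.
have sc := cochain_subspace R Y q.+1; split.
  apply: (lin_subspaceP sc) => //; apply: (lin_subspaceZ _ sc).
  exact: laplacian_cochain.
move=> t; rewrite !fctE /= mulSn [(C + _)%N]addnC addnA.
have [->|ut _] := eqVneq (u t) 0.
  rewrite scaler0 add0r => Lt; apply: (laplacian_near cu ur).
  by apply: contra_neq Lt => ->; rewrite scaler0.
by move=> w wt; apply: leq_trans (ur _ ut _ wt) _; exact: leq_addr.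
Qed.

(** The test is essential: vertices taken from different lifts of a simplex have spanning images
    without spanning a simplex of [Y]. *)
Definition pullback n (F : n.-tuple (set W) -> R^o) : n.-tuple W -> R^o :=
  fun t => if `[< spans_simplex Y t >] then F (mapt pi t) else 0.

Lemma pullback_cochain n (F : n.-tuple (set W) -> R^o) :
  cochain Q F -> cochain Y (pullback F).
Proof.
move=> cF; split=> [t nt|s t]; first by rewrite /pullback asboolF.
rewrite -/(perm_tuple s t) /pullback.
have [st|st] := pselect (spans_simplex Y t); last first.
  by rewrite !asboolF ?mulr0 // => /spans_perm.
rewrite !asboolT ?spans_perm // -(cochain_perm _ _ cF); congr F.
by apply: eq_from_tnth => i; rewrite !(tnth_map, tnth_mktuple).
Qed.

Lemma pullback_coboundary n (F : n.-tuple (set W) -> R^o) : cochain Q F ->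
  coboundary Y (pullback F) = pullback (coboundary Q F).
Proof.
move=> cF; apply/funext => t; rewrite /coboundary [in RHS]/pullback.
case: asboolP => // st; rewrite asboolT; last exact: orbit_spans.
apply: eq_bigr => i _; congr (_ * _).
have -> : tuple_face (mapt pi t) i = mapt pi (tuple_face t i).
  by apply: eq_from_tnth => k; rewrite !(tnth_map, tnth_mktuple).
case: n F cF t st i => [|n] F cF t st i; last first.
  by rewrite /pullback asboolT //; exact: spans_face.
by rewrite /pullback !(cochain0 _ cF) if_same.
Qed.

(** The two sums run over the links of [t] and of its image, which [pi] identifies. *)
Lemma pullback_cocoboundary n (F : n.+1.-tuple (set W) -> R^o) : cochain Q F ->
  cocoboundary Y (pullback F) = pullback (cocoboundary Q F).
Proof.
move=> cF; apply/funext => t; rewrite /cocoboundary [in RHS]/pullback.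
case: asboolP => // st; rewrite asboolT; last exact: orbit_spans.
case: n F cF t st => [|n] F cF t st; first by have := spans_nil st.
pose A := [set v | spans_simplex Y [tuple of v :: t]].
pose B := [set a | spans_simplex Q [tuple of a :: mapt pi t]].
rewrite -(fsbig_widen A setT) //; last first.
  by move=> v [_ nA]; rewrite /= /pullback asboolF.
rewrite -(fsbig_widen B setT) //; last first.
  by move=> a [_ nB] /=; exact: (proj1 cF).
rewrite (reindex_fsbig pi A B); last first.
  split=> [v Av|v v' /[!inE] Av Av'|a /(link_lift st)[v sv <-]].
  - by rewrite /B /= -mapt_cons; exact: orbit_spans.
  - exact: link_inj Av Av'.
  - by exists v.
apply: eq_fsbigr => v /[!inE] Av.
by rewrite /pullback asboolT // mapt_cons.
Qed.

Lemma pullback_laplacian q (F : q.+1.-tuple (set W) -> R^o) : cochain Q F ->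
  laplacian Y (pullback F) = pullback (laplacian Q F).
Proof.
move=> cF; rewrite /laplacian pullback_coboundary // !pullback_cocoboundary //.
- rewrite pullback_coboundary; last exact: cocoboundary_cochain.
  by apply/funext => t; rewrite !fctE /= /pullback; case: ifP => // _; rewrite addr0.
- exact: coboundary_cochain.
Qed.

End Coordinate.
End Quotient.

(** * The trace estimate *)

Section Bessel.
Variables (R : realType) (T : choiceType).

Lemma fdotZr a (f g : T -> R^o) : fdot f (a *: g) = a * fdot f g.
Proof.
by rewrite /fdot mulr_fsumr; apply: eq_fsbigr => t _; rewrite fctE mulrCA.
Qed.

Lemma sum_funE (I : finType) (c : I -> R) (e : I -> T -> R^o) t :
  (\sum_i c i *: e i) t = \sum_i c i * e i t.
Proof. by rewrite fct_sumE. Qed.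

Variables (P : set (T -> R^o)) (ip : inner_product P (@fdot R T)).
Hypothesis Pfin : P `<=` @fin_supp R T.
Variables (I : finType) (F : I -> T -> R^o).
Hypotheses (PF : forall k, P (F k)) (oF : orthonormal_family (@fdot R T) F).

Lemma fdot_subset_le (U : choiceType) (f : U -> T) (D : set U) (h : T -> R^o) :
  fin_supp h -> finite_set D -> {in D &, injective f} ->
  \sum_(u \in D) (h (f u) ^+ 2 : R) <= fdot h h.
Proof.
move=> fh fD injf; pose B := f @` D.
have -> : \sum_(u \in D) (h (f u) ^+ 2 : R) = \sum_(s \in B) (h s ^+ 2 : R).
  by rewrite /B fsbig_image.
have fB : finite_set B by exact: finite_image.
pose A := B `|` [set t | h t != 0].
have fA : finite_set A by rewrite finite_setU.
have -> : fdot h h = \sum_(s \in A) (h s ^+ 2).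
  rewrite (fsbig_widen A setT) // => s [_ nA] /=; apply/eqP.
  by apply: contraT; rewrite sqrf_eq0 => hs; case: nA; right.
rewrite (fsbigID B A) //= (_ : A `&` B = B); last first.
  by apply/seteqP; split=> [s []//|s Bs]; split=> //; left.
by rewrite lerDl; apply: fsumr_ge0 => s _; rewrite sqr_ge0.
Qed.

(* With h = \sum_k c_k F_k, AM-GM gives
   2 \sum_k c_k^2 = 2 <u, h o f> <= |u|^2 + |h|^2 = |u|^2 + \sum_k c_k^2. *)
Lemma local_bessel (U : choiceType) (f : U -> T) (D : set U) (u : U -> R^o) :
  finite_set D -> {in D &, injective f} ->
  \sum_k (\sum_(x \in D) (u x * F k (f x) : R)) ^+ 2 <= \sum_(x \in D) (u x ^+ 2 : R).
Proof.
move=> fD injf; pose c k : R := \sum_(x \in D) (u x * F k (f x)).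
pose h := \sum_k c k *: F k.
have Ph : P h by apply: lin_subspace_sum => //; exact: ip_subspace ip.
have hh : fdot h h = \sum_k c k ^+ 2 by exact: (sqnorm_orthonormal_sum ip).
have := fdot_subset_le (Pfin Ph) fD injf; rewrite hh.
have : \sum_k c k ^+ 2 = \sum_(x \in D) (u x * h (f x)).
  under eq_fsbigr => x _ do rewrite /h sum_funE mulr_sumr.
  rewrite [RHS]fsbig_finite // exchange_big /=; apply: eq_bigr => k _.
  rewrite expr2 {2}/c [X in _ * X]fsbig_finite // mulr_sumr.
  by apply: eq_bigr => x _; rewrite mulrCA.
have : 0 <= \sum_(x \in D) ((u x - h (f x)) ^+ 2 : R).
  by apply: fsumr_ge0 => x _; rewrite sqr_ge0.
rewrite !fsbig_finite //.
under eq_bigr => x _ do rewrite sqrrB -mulr_natl.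
rewrite !big_split /= sumrN -mulr_sumr.
by move: (\sum_k _) => x; lra.
Qed.

(** Bessel's inequality for the indicator of the point [t]. *)
Lemma orthonormal_point_le t : \sum_k F k t ^+ 2 <= 1.
Proof.
have := @local_bessel _ id [set t] (fun=> 1) (finite_set1 t).
rewrite fsbig_set1 expr1n => bes; apply: le_trans (bes _) => //.
by apply: ler_sum => k _; rewrite fsbig_set1 mul1r.
Qed.

(** A trace computed in two ways: #|I| is the sum of the |F k|^2, which is then summed point by
    point. *)
Lemma orthonormal_weighted_card (A : set T) (b a : R) : finite_set A ->
    (forall k t, F k t != 0 -> A t) ->
    (forall t, A t -> b * \sum_k F k t ^+ 2 <= a) ->
  b * #|I|%:R <= a * #|` fset_set A|%:R.
Proof.
move=> fA FA Fa.
have -> : #|I|%:R = \sum_k \sum_(t <- fset_set A) F k t ^+ 2.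
  rewrite -sum1_card natr_sum; apply: eq_bigr => k _.
  have := oF k k; rewrite eqxx => <-; rewrite /fdot (@fsum_finite _ _ A) //.
  by move=> t; rewrite mulf_eq0 orbb; exact: FA.
rewrite exchange_big mulr_sumr /=.
apply: (@le_trans _ _ (\sum_(t <- fset_set A) a)); last first.
  by rewrite big_const_seq count_predT iter_addr_0 mulr_natr.
rewrite big_seq [leRHS]big_seq; apply: ler_sum => t.
by rewrite in_fset_set // inE => /Fa.
Qed.

End Bessel.

(** * Alternating point masses *)

Section Delta.
Variables (R : realType) (V : choiceType) (K : scomplex V) (n : nat).
Variable (t : n.-tuple V).

(** The antisymmetrized indicator of [t], the indicator itself not being alternating in general.
    Pairing with a cochain evaluates it at [t], up to the factor n!. *)
Definition delta_cochain : n.-tuple V -> R^o :=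
  fun u => \sum_(s : 'S_n) (-1) ^+ s * (u == perm_tuple s t)%:R.

Lemma delta_cochain_neq0 u : delta_cochain u != 0 -> exists s, u = perm_tuple s t.
Proof.
move=> h; apply: contrapT => /forallNP ns; move: h.
rewrite /delta_cochain big1 ?eqxx // => s _.
by case: eqP => [/ns//|]; rewrite mulr0.
Qed.

Let A : set (n.-tuple V) := [set perm_tuple s t | s in [set: 'S_n]].

Let finA : finite_set A.
Proof. by apply: finite_image; exact: finite_finset. Qed.

Lemma delta_cochain_fin : fin_supp delta_cochain.
Proof. by apply: (fin_supp_sub finA) => u /delta_cochain_neq0[s ->]; exists s. Qed.

Lemma fdot_delta (f : n.-tuple V -> R^o) : cochain K f ->
  fdot delta_cochain f = n`!%:R * f t.
Proof.
move=> cf; rewrite /fdot (@fsum_finite _ _ A _ finA); last first.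
  move=> u h; have /delta_cochain_neq0[s ->] : delta_cochain u != 0.
    by apply: contra_neq h => ->; rewrite mul0r.
  by exists s.
under eq_bigr => u _ do rewrite mulr_suml.
rewrite exchange_big /= (eq_bigr (fun=> f t)) => [|s _].
  by rewrite sumr_const mulr_natl card_Sn.
have sA : perm_tuple s t \in fset_set A by rewrite in_fset_set // inE; exists s.
rewrite (bigD1_seq (perm_tuple s t)) ?fset_uniq //=.
rewrite eqxx mulr1 (cochain_perm s t cf) mulrA -signr_addb addbb mul1r.
by rewrite big1 ?addr0 // => u /negPf ->; rewrite mulr0 mul0r.
Qed.

Lemma delta_cochain_alternating : spans_simplex K t -> cochain K delta_cochain.
Proof.
move=> st; split=> [u nu|r u]; rewrite -?/(perm_tuple r u).
  apply/eqP; apply: contraT => /delta_cochain_neq0[s us].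
  by case: nu; rewrite us spans_perm.
rewrite /delta_cochain mulr_sumr (reindex_inj (mulgI r)) /=.
apply: eq_bigr => s _; rewrite odd_permM signr_addb -mulrA; congr (_ * (_ * _%:R)).
have -> : perm_tuple (r * s)%g t = perm_tuple r (perm_tuple s t).
  by apply: eq_from_tnth => i; rewrite !tnth_mktuple permM.
by rewrite (bij_eq (perm_tuple_bij V r)).
Qed.

Lemma sqnorm_delta : spans_simplex K t -> fdot delta_cochain delta_cochain = n`!%:R.
Proof.
move=> st; rewrite fdot_delta; last exact: delta_cochain_alternating.
rewrite /delta_cochain (bigD1 (1%g : 'S_n)) //= odd_perm1 expr0 mul1r.
have -> : perm_tuple (1%g : 'S_n) t = t.
  by apply: eq_from_tnth => i; rewrite tnth_mktuple perm1.
rewrite eqxx big1 ?addr0 ?mulr1 // => s s1.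
case: eqP => [ts|]; last by rewrite mulr0.
case/eqP: s1; apply/permP => i; rewrite perm1.
have /tuple_uniqP := st.1; apply.
by rewrite [RHS]/= {2}ts tnth_mktuple.
Qed.

End Delta.

(** * Harmonic cochains and eigencochains of a finite complex *)

Section FiniteComplex.
Variables (R : realType) (V : choiceType) (K : scomplex V) (D q : nat).
Hypotheses (finK : forall n, finite_set (spanning_tuples K n)).
Hypothesis degK : bounded_degree K D.
Local Notation T := (q.+1.-tuple V -> R^o).
Local Notation ip := (fin_cochain_ip R K q.+1).

Lemma cochain_fin n (f : n.-tuple V -> R^o) : cochain K f -> fin_cochain K f.
Proof.
by move=> cf; split=> //; apply: fin_supp_sub (finK n) _ => t /(cochain_spans cf).
Qed.

(** Supplies the dimension bound that [quotient_dim_orthonormal] requires. *)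
Lemma card_orthonormal_cochains (I : finType) (e : I -> T) :
  (forall k, cochain K (e k)) -> orthonormal_family (@fdot R _) e ->
  (#|I| <= #|` fset_set (spanning_tuples K q.+1)|)%N.
Proof.
move=> ce oe; rewrite -(ler_nat R) -[leLHS]mul1r -[leRHS]mul1r.
apply: (orthonormal_weighted_card oe (finK _)) => [k t|t _].
  exact: cochain_spans (ce k).
rewrite mul1r; apply: (orthonormal_point_le ip _ _ oe) => [f []//|k].
exact: cochain_fin.
Qed.

Lemma quotient_dim_cochains (Z B : set T) : lin_subspace Z -> lin_subspace B ->
    B `<=` Z -> Z `<=` @cochain R V K q.+1 ->
  exists e : 'I_(quotient_dim Z B) -> T, [/\ forall i, Z (e i),
    forall i b, B b -> fdot (e i) b = 0 & orthonormal_family (@fdot R _) e].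
Proof.
move=> sZ sB BZ Zc; rewrite /quotient_dim.
(* In the second case [quotient_dim] has its default value 0, and the empty family serves. *)
case: xgetP => [n _ dn|_]; last by exists (fun=> 0); split=> -[].
apply: (quotient_dim_orthonormal ip sZ sB BZ _ _ dn).
  by move=> f /Zc; exact: cochain_fin.
move=> m e Ze oe; rewrite -[m]card_ord; apply: (card_orthonormal_cochains _ oe).
by move=> k; exact: Zc.
Qed.

(** The double sum over v and w changes sign when the two are swapped. The dual identity for
    [coboundary] follows by adjointness, which spares the bookkeeping of iterated faces. *)
Lemma cocoboundaryK n (g : n.+2.-tuple V -> R^o) : cochain K g ->
  cocoboundary K (cocoboundary K g) = 0.
Proof.
move=> cg; pose A := \bigcup_(t in spanning_tuples K n.+2) [set` (t : seq V)].
have fA : finite_set A by apply: bigcup_finite => // t _; exact: finite_seq.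
have gA (t : n.-tuple V) v w : g [tuple of w :: [tuple of v :: t]] != 0 -> A v /\ A w.
  move=> /(cochain_spans cg) st; split; exists [tuple of w :: [tuple of v :: t]] => //=;
    by rewrite !inE eqxx ?orbT.
have swap (t : n.-tuple V) v w :
    g [tuple of v :: [tuple of w :: t]] = - g [tuple of w :: [tuple of v :: t]].
  pose o1 : 'I_n.+2 := lift ord0 ord0.
  have <- : perm_tuple (tperm ord0 o1) [tuple of w :: [tuple of v :: t]] =
      [tuple of v :: [tuple of w :: t]].
    apply: eq_from_tnth => i; rewrite tnth_mktuple.
    case: (unliftP ord0 i) => [j ->|->]; last by rewrite tpermL tnthS !tnth0.
    case: (unliftP ord0 j) => [k ->|->]; last by rewrite tpermR tnthS !tnth0.
    by rewrite tpermD ?neq_lift ?(inj_eq (@lift_inj _ _)) ?neq_lift // !tnthS.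
  by rewrite (cochain_perm _ _ cg) odd_tperm (negPf (neq_lift _ _)) /= expr1 mulN1r.
apply/funext => t; rewrite /cocoboundary; case: asboolP => // st.
have -> : \sum_(v \in [set: V]) (if `[< spans_simplex K [tuple of v :: t] >]
    then \sum_(w \in [set: V]) g [tuple of w :: [tuple of v :: t]] else 0) =
  \sum_(v \in A) \sum_(w \in A) (g [tuple of w :: [tuple of v :: t]] : R).
  rewrite -(fsbig_widen A setT) //; last first.
    move=> v [_ nA] /=; case: asboolP => // _; apply: fsbig1 => w _.
    by apply/eqP; apply: contraT => /gA[/nA].
  apply: eq_fsbigr => v _; rewrite -(fsbig_widen A setT) //; last first.
    by move=> w [_ nA] /=; apply/eqP; apply: contraT => /gA[_ /nA].
  case: asboolP => // nv; rewrite fsbig1 // => w _; apply: (proj1 cg).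
  by move=> /spans_behead.
set x := \sum_(v \in A) _; suff /eqP : x = - x by rewrite -addr_eq0 -mulr2n mulrn_eq0 => /eqP.
rewrite {1}/x exchange_fsbig // /x -mulN1r mulr_fsumr; apply: eq_fsbigr => v _.
by rewrite mulr_fsumr; apply: eq_fsbigr => w _; rewrite mulN1r; exact: swap.
Qed.

(** Two adjunctions turn |ddf|^2 into a multiple of a pairing of f with a double cocoboundary, which
    is zero. *)
Lemma coboundaryK n (f : n.-tuple V -> R^o) : cochain K f ->
  coboundary K (coboundary K f) = 0.
Proof.
move=> cf; have cdf := coboundary_cochain cf; have cddf := coboundary_cochain cdf.
apply: (fdot_eq0 (cochain_fin cddf).2).
rewrite (coboundary_adjoint degK cdf cddf); last by right; exact: (cochain_fin cddf).2.
have cw := cocoboundary_cochain cddf.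
rewrite (coboundary_adjoint degK cf cw); last by right; exact: (cochain_fin cw).2.
rewrite cocoboundaryK // /fdot fsbig1 ?mulr0 // => t _.
by rewrite mulr0.
Qed.

Lemma harmonic_family : exists e : 'I_(betti R K q) -> T,
  [/\ forall i, fin_cochain K (e i), forall i, laplacian K (e i) = 0
    & orthonormal_family (@fdot R _) e].
Proof.
have cob0 n : coboundary K (0 : n.-tuple V -> R^o) = 0.
  by apply/funext => t; rewrite /coboundary big1 ?if_same // => i _; rewrite mulr0.
have [||||e [Ze eB oe]] :=
    @quotient_dim_cochains (@cocycles R V K q) (@coboundaries R V K q).
- split=> [|a f g [cf df] [cg dg]].
    by split; [exact: lin_subspace0 (cochain_subspace _ _ _)|exact: cob0].
  split; first by apply: (lin_subspaceP (cochain_subspace _ _ _)).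
  by rewrite coboundary_lin df dg scaler0 addr0.
- split=> [|a _ _ [f cf <-] [g cg <-]].
    by exists 0; [exact: lin_subspace0 (cochain_subspace _ _ _)|exact: cob0].
  exists (a *: f + g); last exact: coboundary_lin.
  by apply: (lin_subspaceP (cochain_subspace _ _ _)).
- move=> _ [f cf <-]; split; first exact: coboundary_cochain.
  exact: coboundaryK.
- by move=> f [].
exists e; split=> // i; have [ce de] := Ze i; first exact: cochain_fin.
apply: (harmonic degK) => // [|b [cb _]]; first exact: cochain_fin.
by apply: eB; exists b.
Qed.

Lemma eigenvalue_family lam : exists (I : finType) (e : I -> T) (mu : I -> R),
  [/\ #|I| = eigenvalue_count K q lam, forall i, fin_cochain K (e i),
      forall i, laplacian K (e i) = mu i *: e i, forall i, mu i <= lam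
    & orthonormal_family (@fdot R _) e].
Proof.
pose d m := quotient_dim (@laplacian_eigenspace R V K q m) [set 0].
(* If infinitely many terms were nonzero the count would be 0 by convention, and the empty list
   would do. *)
have [r [ur rlam rE]] : exists r : seq R, [/\ uniq r,
    forall m, m \in r -> m <= lam & eigenvalue_count K q lam = \sum_(m <- r) d m].
  rewrite /eigenvalue_count; case: finite_supportP => [_|X Xsub _ _].
    by exists [::]; split.
  by exists (enum_fset X); split=> [|m mX|//]; [exact: fset_uniq|exact: Xsub].
have fam m : exists e : 'I_(d m) -> T,
    (forall i, laplacian_eigenspace K m (e i)) /\ orthonormal_family (@fdot R _) e.
  have sE : lin_subspace (@laplacian_eigenspace R V K q m).
    split=> [|a f g [cf Lf] [cg Lg]].
      have c0 : cochain K (0 : T) by exact: lin_subspace0 (cochain_subspace _ _ _).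
      split=> //; have f0 := cochain_fin c0; have := laplacian_lin degK 1 f0 f0.
      by rewrite !scale1r addr0 -{1}[laplacian K 0]addr0 scaler0 => /addrI.
    split; first by apply: (lin_subspaceP (cochain_subspace _ _ _)).
    rewrite (laplacian_lin degK) ?Lf ?Lg; try exact: cochain_fin.
    by rewrite scalerDr !scalerA mulrC.
  have [||||e [Ze _ oe]] := @quotient_dim_cochains (@laplacian_eigenspace R V K q m) [set 0].
  - exact: sE.
  - by split=> // a f g -> ->; rewrite scaler0 addr0.
  - by move=> _ ->; exact: (lin_subspace0 sE).
  - by move=> f [].
  by exists e.
pose e m := sval (cid (fam m)).
have [eE oe] := all_and2 (fun m => svalP (cid (fam m))).
pose I : finType := {i : 'I_(size r) & 'I_(d r`_i)}.
exists I, (fun x : I => e r`_(tag x) (tagged x)), (fun x : I => r`_(tag x)); split.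
- rewrite card_tagged sumnE big_map big_enum rE (big_nth 0) big_mkord.
  by apply: eq_bigr => i _; rewrite card_ord.
- by move=> x; apply: cochain_fin; exact: (eE _ _).1.
- by move=> x; exact: (eE _ _).2.
- by move=> x; apply: rlam; exact: mem_nth.
move=> [i k] [j l]; rewrite /= -tag_eqE /tag_eq /=.
have [ij|ij] := eqVneq i j.
  by move: l; rewrite -ij => l; rewrite tagged_asE; exact: oe.
have [ck Lk] := eE r`_i k; have [cl Ll] := eE r`_j l.
have : r`_i != r`_j by rewrite nth_uniq.
(* For distinct eigenvalues m and m', symmetry gives (m - m') <e, e'> = 0. *)
have := laplacian_dotr degK (cochain_fin ck) cl.
rewrite Lk Ll fdotZr fdotC fdotZr fdotC -/(e _ _) => /eqP.
by rewrite -subr_eq0 -mulrBl mulf_eq0 subr_eq0 => /orP[->//|/eqP ->].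
Qed.

End FiniteComplex.

(** * The estimate on one quotient *)

Section Estimate.
Variables (R : realType) (G : groupType) (V W : choiceType).
Variables (X : scomplex V) (Y : scomplex W) (p : W -> V) (act : G -> W -> W).
Hypotheses (X_finite : finite_set (simplex X)).
Hypotheses (cov : regular_covering act Y X p).
Variables (S : {fset G}) (gam : W -> G) (C : nat).
Hypothesis genS : generates S.
Hypothesis gamM : forall g w, Y [fset w]%fset -> gam (act g w) = (g * gam w)%g.
Hypothesis gamC : forall w w', spans_simplex Y [tuple w; w'] ->
  (word_length S ((gam w)^-1 * gam w')%g <= C)%N.
Variables (q : nat) (K l0 lam : R).
Hypotheses (l0K : 0 < l0 < K) (lam0 : lam < l0).
Hypothesis form_ge : forall u, @fin_cochain R _ Y q.+1 u ->
  l0 * fdot u u <= fdot (laplacian Y u) u.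
Hypothesis form_le : forall u, @fin_cochain R _ Y q.+1 u ->
  fdot (laplacian Y u) u <= K * fdot u u.
Variables (H : set G).
Hypotheses (nH : normal_subgroup H) (iH : finite_index H).
Local Notation Q := (quotient_complex act H Y).
Local Notation pi := (orbit_map act H).
Variables (I : finType) (F : I -> q.+1.-tuple (set W) -> R^o) (mu : I -> R).
Hypotheses (finF : forall k, fin_cochain Q (F k)).
Hypotheses (eigF : forall k, laplacian Q (F k) = mu k *: F k).
Hypotheses (muF : forall k, mu k <= lam).
Hypothesis oF : orthonormal_family (@fdot R _) F.

Let degY := bounded_degree_cover X_finite cov.
Let A (u : q.+1.-tuple W -> R^o) := 1 *: u + (- K^-1) *: laplacian Y u.

(** The pullback is an eigencochain of the Laplacian on [Y], though perhaps not square summable;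
    since [u] is finitely supported, each application of A can still be moved across the pairing. *)
Lemma fdot_iter_pullback j k (u : q.+1.-tuple W -> R^o) : fin_cochain Y u ->
  fdot (iter j A u) (pullback Y act H (F k)) =
    (1 - mu k / K) ^+ j * fdot u (pullback Y act H (F k)).
Proof.
move=> fu; set f := pullback _ _ _ _.
have cf : cochain Y f by apply: pullback_cochain; exact: (finF k).1.
have Lf : laplacian Y f = mu k *: f.
  rewrite (pullback_laplacian cov nH); last exact: (finF k).1.
  rewrite eigF; apply/funext => t; rewrite /f /pullback !fctE.
  by case: ifP => _; rewrite ?scaler0.
have symA := symmetric_op_affine (fin_cochain_ip R Y q.+1) 1 (- K^-1) (laplacian_symmetric R degY q).
have fj i : fin_cochain Y (iter i A u).
  by elim: i => [//|i IH]; exact: (sym_stable symA IH).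
elim: j => [|j IH]; first by rewrite mul1r.
have sF := fin_cochain_subspace R Y q.+1.
have fLj : fin_cochain Y (laplacian Y (iter j A u)) by exact: (laplacian_fin degY).
rewrite iterS {1}/A fdot_lin; [|exact: (fj j).2|exact: (lin_subspaceZ _ sF fLj).2].
rewrite -[_ *: laplacian _ _]addr0 fdot_lin; [|exact: fLj.2|exact: (lin_subspace0 sF).2].
rewrite (laplacian_dotr degY (fj j) cf) Lf fdotZr IH exprS.
rewrite (_ : fdot 0 f = 0); last by rewrite /fdot fsbig1 // => t _; rewrite mul0r.
ring.
Qed.

(** A point mass at [t] has radius C about the coordinate of its first vertex, and each of the j
    applications of A adds C; twice the total must stay below [short] for [near_orbit_inj]. *)
Lemma eigenfamily_estimate j : (C + j * C + (C + j * C) < short S H)%N ->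
  (1 - lam / K) ^+ j.*2 * #|I|%:R <=
  (1 - l0 / K) ^+ j.*2 * #|` fset_set (spanning_tuples Q q.+1)|%:R.
Proof.
move=> jH; have ip := fin_cochain_ip R Q q.+1.
have fS := finite_spanning_quotient X_finite cov nH iH gamM q.+1.
have [l00 lK] := andP l0K; have K0 : 0 < K by lra.
apply: (orthonormal_weighted_card oF fS) => [k t|s /orbit_lift[t st ts]].
  exact: cochain_spans (finF k).1.
have cd := delta_cochain_alternating R st.
have fd : fin_cochain Y (delta_cochain R t) by split=> //; exact: delta_cochain_fin.
have dnear : forall u, delta_cochain R t u != 0 -> within_radius S gam (gam (tnth t ord0)) C u.
  move=> u /delta_cochain_neq0[r ->] w; rewrite (perm_mem (perm_eq_perm_tuple r t)) => wt.
  exact: (adjacent_coordinate gamC st (mem_tnth _ _) wt).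
have [[cu fu] ule] := iter_affine_sqnorm (fin_cochain_ip R Y q.+1) j
  (laplacian_symmetric R degY q) l0K form_ge form_le fd.
have [_ unear] := iter_near genS gamC 1 (- K^-1) j cd dnear.
rewrite (sqnorm_delta R st) in ule.
set u := iter j _ _ in cu fu ule unear.
(* On the support of u = A^j delta the projection to the quotient is injective, so [local_bessel]
   applies with this set. *)
pose D := [set x | u x != 0].
have injD : {in D &, injective (map_tuple pi (n:=q.+1))}.
  move=> x y /[!inE] ux uy; apply: (near_orbit_inj cov nH genS gamM jH).
  - exact: cochain_spans cu ux.
  - exact: unear.
  - exact: unear.
have := local_bessel ip (fun f fF => fF.2) finF oF u fu injD.
have -> : \sum_(x \in D) (u x ^+ 2 : R) = fdot u u.
  rewrite (fsbig_widen D setT) //.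
  by move=> x [_ /negP/negPn/eqP ux] /=; rewrite ux expr0n.
have n0 : 0 < q.+1`!%:R :> R by rewrite ltr0n fact_gt0.
have cE k : \sum_(x \in D) (u x * F k (map_tuple pi x) : R) =
    (1 - mu k / K) ^+ j * (q.+1`!%:R * F k s).
  rewrite -ts; have -> : F k (map_tuple pi t) = pullback Y act H (F k) t.
    by rewrite /pullback asboolT.
  rewrite -(fdot_delta t (K := Y)); last by apply: pullback_cochain; exact: (finF k).1.
  rewrite -fdot_iter_pullback // -/u /fdot -(fsbig_widen D setT) //; last first.
    by move=> x [_ /negP/negPn/eqP ux] /=; rewrite ux mul0r.
  apply: eq_fsbigr => x /[!inE] ux; rewrite /pullback asboolT //.
  exact: cochain_spans cu ux.
under eq_bigr => k _ do rewrite cE exprMn -exprM muln2 exprMn.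
move=> h; set b := (1 - lam / K) ^+ j.*2; set T := \sum_k F k s ^+ 2.
have b1 : 0 <= 1 - lam / K.
  by rewrite subr_ge0 ler_pdivrMr // mul1r ltW // (lt_trans lam0).
have bT : 0 <= b * T.
  apply: mulr_ge0; first exact: exprn_ge0.
  by apply: sumr_ge0 => k _; rewrite sqr_ge0.
(* The point mass has squared norm n!, while its squared pairings carry n!^2, where n = q + 1; the
   surplus factor n! >= 1 is discarded. *)
apply: (@le_trans _ _ (q.+1`!%:R * (b * T))).
  by rewrite ler_peMl // ler1n fact_gt0.
rewrite -(ler_pM2l n0) [leRHS]mulrC; apply: le_trans ule; apply: le_trans h.
rewrite /T !mulr_sumr; apply: ler_sum => k _.
rewrite [leLHS](_ : _ = b * (q.+1`!%:R ^+ 2 * F k s ^+ 2)); last by ring.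
apply: ler_wpM2r.
  by apply: mulr_ge0; [exact: sqr_ge0|exact: sqr_ge0].
apply: lerXn2r; rewrite ?nnegrE //.
  by rewrite subr_ge0 ler_pdivrMr // mul1r (le_trans (muF k)) // ltW // (lt_trans lam0).
by rewrite lerD2l lerN2 ler_pM2r ?invr_gt0.
Qed.

Lemma eigenfamily_decay : (0 < C)%N ->
  #|I|%:R <= #|` fset_set (spanning_tuples Q q.+1)|%:R *
    (((1 - l0 / K) / (1 - lam / K)) ^+ 2) ^+ (short S H %/ (5 * C)).
Proof.
(* For j >= 1 one has 2 (C + j C) <= 4 j C < 5 j C <= short, which explains the 5. *)
move=> C0; set j := (_ %/ _)%N; set N := #|` _|.
have [l00 lK] := andP l0K; have K0 : 0 < K by lra.
(* When [short] is too small for a single step, the dimension bound is the claim. *)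
have [j0|j0] := posnP j.
  rewrite j0 expr0 mulr1 ler_nat.
  apply: card_orthonormal_cochains oF => [n|k]; last exact: (finF k).1.
  exact: (finite_spanning_quotient X_finite cov nH iH gamM).
have b0 : 0 < 1 - lam / K by rewrite subr_gt0 ltr_pdivrMr // mul1r (lt_trans lam0).
rewrite -exprM mul2n expr_div_n mulrA ler_pdivlMr ?exprn_gt0 //.
rewrite mulrC [leRHS]mulrC; apply: eigenfamily_estimate.
have : (j * (5 * C) <= short S H)%N by exact: leq_trunc_div.
apply: leq_trans; nia.
Qed.

End Estimate.

(** The common source of both conclusions. The coordinates, C, the degree bound and K depend on the
    covering and the two thresholds only, so the final constants are fixed before [i]. *)
Lemma eigenfamily_growth (R : realType)
    (V W : choiceType) (X : scomplex V) (Y : scomplex W) (p : W -> V)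
    (G : groupType) (S : {fset G}) (act : G -> W -> W)
    (I : Type) (Gi : I -> set G) (q : nat) (l0 lam : R) :
    finite_set (simplex X) -> generates S ->
    regular_covering act Y X p ->
    (forall i, normal_subgroup (Gi i)) -> (forall i, finite_index (Gi i)) ->
    uniform_family R S Gi -> 0 < l0 -> lam < l0 ->
    (forall mu : R, laplacian_spectrum Y q mu -> l0 <= mu) ->
  exists A beta : R, [/\ 0 < A, beta < 1 &
    forall i (J : finType) (F : J -> q.+1.-tuple (set W) -> R^o) (mu : J -> R),
      let Q := quotient_complex act (Gi i) Y in
      (forall k, fin_cochain Q (F k)) ->
      (forall k, laplacian Q (F k) = mu k *: F k) ->
      (forall k, mu k <= lam) -> orthonormal_family (@fdot R _) F ->
      #|J|%:R < A * (subgroup_index (Gi i))%:R `^ beta].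
Proof.
move=> fX genS cov nG iG [c c0 unif] l00 laml0 gap.
have [gam [C [C0 gamM gamC]]] := group_coordinate fX cov S.
have degY := bounded_degree_cover fX cov.
pose D := #|` fset_set (vertices X)|.+1.
pose K0 : R := (q.+2%:R + q.+1%:R) * D%:R.
have K00 : 0 <= K0 by rewrite /K0 mulr_ge0 // addr_ge0.
(* K dominates the form bound [K0] and exceeds [l0], so that 1 - l0 / K is positive and the ratio
   below lies strictly between 0 and 1. *)
pose K := K0 + l0 + `|lam| + 1.
have l0K : 0 < l0 < K by rewrite l00 /=; have := normr_ge0 lam; rewrite /K; lra.
have K_gt0 : 0 < K by case/andP: l0K => ? ?; lra.
have form_le u : @fin_cochain R _ Y q.+1 u -> fdot (laplacian Y u) u <= K * fdot u u.
  move=> fu; apply: le_trans (laplacian_form_le degY (ltn0Sn _) fu) _.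
  apply: ler_wpM2r; first exact: fdot_ge0.
  by rewrite -/K0 /K; have := normr_ge0 lam; lra.
have form_ge := laplacian_gap degY (ltn0Sn _) (ltW l00) gap.
pose rho := ((1 - l0 / K) / (1 - lam / K)) ^+ 2.
have a0 : 0 < 1 - l0 / K.
  by rewrite subr_gt0 ltr_pdivrMr // mul1r; case/andP: l0K.
have ab : 1 - l0 / K < 1 - lam / K.
  by rewrite ltrD2l ltrN2 ltr_pM2r ?invr_gt0.
have b0 := lt_trans a0 ab.
have rho01 : 0 < rho < 1.
  rewrite exprn_gt0 ?divr_gt0 //= exprn_ilt1 // ?divr_ge0 ?(ltW a0) ?(ltW b0) //.
  by rewrite ltr_pdivrMr // mul1r.
(* One more than the base in [vol_le], so that M > 1 even for empty [S]; [n] is an integer above the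
   uniformity constant c. *)
pose M := (#|` S|).*2.+2; pose n := (Num.truncn c).+1.
have [A [beta [A0 beta1 AP]]] := @exp_decay_powR R rho M n (5 * C)
  #|` fset_set (spanning_tuples X q.+1)| rho01 isT (ltn0Sn _) (ltac:(by rewrite muln_gt0 C0)).
exists A, beta; split=> // i J F mu Q fF eF muF oF.
have [_ cardQ] := card_spanning_quotient fX cov (nG i) (iG i) gamM q.
apply: (AP _ _ _ (short S (Gi i))) cardQ _.
- exact: subgroup_index_gt0.
- apply: leq_trans (unif i) _.
  apply: (@leq_trans ((#|` S|).*2.+1 ^ (n * short S (Gi i)))); last first.
    by case: (posnP (n * short S (Gi i))) => [->//|e0]; rewrite leq_exp2r.
  apply: vol_le => //; rewrite natrM ler_wpM2r //.
  by rewrite ltW // truncnS_gt.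
- exact: (eigenfamily_decay fX cov genS gamM gamC l0K laml0 form_ge form_le (nG i) (iG i) fF eF muF oF C0).
Qed.

Theorem theorem0p2 (R : realType)
    (V W : choiceType) (X : scomplex V) (Xt : scomplex W) (p : W -> V)
    (G : groupType) (S : {fset G}) (act : G -> W -> W)
    (I : Type) (Gi : I -> set G) (q : nat) (lambda0 : R)
    (X_finite : finite_set (simplex X))
    (S_generates : generates S)
    (G_infinite : infinite_set [set: G])
    (Xt_covering : regular_covering act Xt X p)
    (G_growth : exponential_growth R S)
    (Gi_normal : forall i, normal_subgroup (Gi i))
    (Gi_index : forall i, finite_index (Gi i))
    (Gi_uniform : uniform_family R S Gi)
    (lambda0_gt0 : 0 < lambda0)
    (spectral_gap : forall mu : R, laplacian_spectrum Xt q mu -> lambda0 <= mu) :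
  (exists C beta : R, [/\ 0 < C, beta < 1 & forall i,
     (betti R (quotient_complex act (Gi i) Xt) q)%:R
       < C * (subgroup_index (Gi i))%:R `^ beta]) /\
  (forall lambda : R, lambda < lambda0 ->
   exists C beta : R, [/\ 0 < C, beta < 1 & forall i,
     (eigenvalue_count (quotient_complex act (Gi i) Xt) q lambda)%:R
       < C * (subgroup_index (Gi i))%:R `^ beta]).
Proof.
have growth lam := @eigenfamily_growth R V W X Xt p G S act I Gi q lambda0 lam
  X_finite S_generates Xt_covering Gi_normal Gi_index Gi_uniform lambda0_gt0.
have [gam [_ [_ gamM _]]] := group_coordinate X_finite Xt_covering S.
have finQ i := finite_spanning_quotient X_finite Xt_covering (Gi_normal i) (Gi_index i) gamM.
have degQ i := bounded_degree_quotient Xt_covering (Gi_normal i)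
  (bounded_degree_cover X_finite Xt_covering).
split=> [|lambda lambda_lt].
  have [A [beta [A0 beta1 AP]]] := growth 0 lambda0_gt0 spectral_gap.
  exists A, beta; split=> // i; have [e [fe Le oe]] := harmonic_family R q (finQ i) (degQ i).
  rewrite -[X in X%:R]card_ord; apply: (AP i _ e (fun=> 0)) => // k.
  by rewrite Le scale0r.
have [A [beta [A0 beta1 AP]]] := growth _ lambda_lt spectral_gap.
exists A, beta; split=> // i.
have [J [e [mu [<- fe Le mule oe]]]] := eigenvalue_family q (finQ i) (degQ i) lambda.
exact: AP fe Le mule oe.
Qed.
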